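(* For all $n\ge1$ and all $\sigma\in S_n(321)$, $(\mathrm{fp},\mathrm{exc},\mathrm{crs})(\Theta(\sigma))=(\mathrm{fp},\mathrm{exc},\mathrm{crs})(\sigma)$; i.e. $\Theta$ preserves the number of fixed points, of excedances and of crossings.
   Context: $S_n(\tau)$: permutations of $[n]$ avoiding the pattern $\tau$. For $\sigma\in S_n$: $\mathrm{fp}(\sigma)=|\{i:\sigma(i)=i\}|$, $\mathrm{exc}(\sigma)=|\{i:\sigma(i)>i\}|$; a crossing is a pair $(i,j)$ with $i<j<\sigma(i)<\sigma(j)$ or $\sigma(i)<\sigma(j)\le i<j$, and $\mathrm{crs}(\sigma)$ is their number. Definition of $\Theta$: for $\sigma\in S_n(321)$ let $(P,Q)$ be the insertion and recording tableaux of the RSK correspondence applied to $\sigma$ (at most two rows). $\Psi(\sigma)$ is the path of $2n$ steps $u=(1,1)$, $d=(1,-1)$ whose first $n$ steps are, for $i=1,\dots,n$, $u$ if $i$ is in the first row of $P$ and $d$ if in the second, and whose last $n$ steps are, for $j=n,\dots,1$, $u$ if $j$ is in the second row of $Q$ and $d$ if in the first; it is a Dyck path. Each up-step is matched with the first later down-step ending at the height where the up-step starts. Labelling up-steps left to right $n,\dots,1$ and down-steps left to right $1,\dots,n$, $\Phi^{-1}(D)$ sends each up-step label to the label of its matched down-step; it is a bijection onto $S_n(132)$. $\Theta=\Phi^{-1}\circ\Psi$. *)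

(* Defs.v *)
From HB Require Import structures.
From mathcomp Require Import all_boot all_order ssralg ssrnum ssrint.
From mathcomp Require Import fingroup perm zify.

Set Implicit Arguments.
Unset Strict Implicit.
Unset Printing Implicit Defensive.

Import Order.TTheory.

(* Permutations of {1, ..., n} are elements of 'S_n, i.e., permutations of    *)
(* {0, ..., n - 1}: positions, values, tableau entries and step labels are    *)
(* all shifted down by 1.                                                     *)

Section Statistics.

Variables (n : nat) (s : 'S_n).

Definition fp := #|[set i : 'I_n | s i == i]|.

Definition exc := #|[set i : 'I_n | i < s i]|.

Definition crossing (i j : 'I_n) : bool :=
  [&& i < j, j < s i & s i < s j] || [&& s i < s j, s j <= i & i < j].

Definition crs := #|[set ij : 'I_n * 'I_n | crossing ij.1 ij.2]|.

(* The pattern t is given in one-line notation; only the relative order of    *)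
(* its entries matters.                                                       *)
Definition contains (t : seq nat) : bool :=
  [exists f : {ffun 'I_(size t) -> 'I_n},
     [forall i : 'I_(size t), forall j : 'I_(size t),
        ((i < j) ==> (f i < f j)) &&
        ((s (f i) < s (f j)) == (nth 0 t i < nth 0 t j))]].

End Statistics.

Definition Av (n : nat) (t : seq nat) : {set 'S_n} :=
  [set s : 'S_n | ~~ contains s t].

(* Row insertion of x into the tableau T (a list of rows); the second         *)
(* component is the index of the row that has grown.                          *)
Fixpoint row_insert (x : nat) (T : seq (seq nat)) : seq (seq nat) * nat :=
  if T is r :: T' then
    let k := find (fun y => x < y) r in
    if k < size r then
      let: (T'', i) := row_insert (nth 0 r k) T' in (set_nth 0 r k x :: T'', i.+1)
    else (rcons r x :: T', 0)
  else ([:: [:: x]], 0).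

Definition rsk_step (PQ : seq (seq nat) * seq (seq nat)) (jx : nat * nat) :=
  let: (P, i) := row_insert jx.2 PQ.1 in
  (P, set_nth [::] PQ.2 i (rcons (nth [::] PQ.2 i) jx.1)).

Definition RSK (w : seq nat) : seq (seq nat) * seq (seq nat) :=
  foldl rsk_step ([::], [::]) (zip (iota 0 (size w)) w).

Definition word (n : nat) (s : 'S_n) : seq nat :=
  [seq (s i : nat) | i <- enum 'I_n].

(* Paths are sequences of booleans: true is u = (1, 1), false is d = (1, -1). *)
Definition Psi (n : nat) (s : 'S_n) : seq bool :=
  let: (P, Q) := RSK (word s) in
  [seq i \in nth [::] P 0 | i <- iota 0 n] ++
  [seq j \in nth [::] Q 1 | j <- rev (iota 0 n)].

(* The height of the path after its first k steps. *)
Definition height (D : seq bool) (k : nat) : int :=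
  ((count id (take k D))%:Z - (count negb (take k D))%:Z)%R.

Definition up_steps (D : seq bool) : seq nat :=
  [seq p <- iota 0 (size D) | nth false D p].

Definition down_steps (D : seq bool) : seq nat :=
  [seq p <- iota 0 (size D) | ~~ nth false D p].

(* The position of the down-step matched with the up-step at position p, or   *)
(* size D if there is none.                                                   *)
Definition match_step (D : seq bool) (p : nat) : nat :=
  find (fun q => [&& p < q, ~~ nth false D q & height D q.+1 == height D p])
       (iota 0 (size D)).

(* From the label of an up-step (right to left) to the label of the matched   *)
(* down-step (left to right).                                                 *)
Definition Phi_inv_label (D : seq bool) (i : nat) : nat :=
  index (match_step D (nth 0 (rev (up_steps D)) i)) (down_steps D).

(* The default values of insubd are only used when D is not a Dyck path of    *)
(* length 2n, see Phi_invE below.                                             *)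
Definition Phi_inv (n : nat) (D : seq bool) : 'S_n :=
  insubd (1%g : 'S_n) [ffun i : 'I_n => insubd i (Phi_inv_label D i)].

Definition Theta (n : nat) (s : 'S_n) : 'S_n := Phi_inv n (Psi s).

Definition Dyck (n : nat) (D : seq bool) : Prop :=
  [/\ size D = n.*2, height D n.*2 = 0%R & forall k, (0 <= height D k)%R].

(* Sanity: Theta is the intended map on Av n [:: 3; 2; 1].                    *)

Section PhiInv.

Variables (n : nat) (D : seq bool).
Hypothesis DyckD : Dyck n D.

Lemma heightS k : k < size D ->
  height D k.+1 = (height D k + (if nth false D k then 1 else -1))%R.
Proof.
move=> ltk; rewrite /height (take_nth false ltk) -cats1 !count_cat /=.
by case: (nth _ _ _) => /=; lia.
Qed.

Lemma count_up : count id D = n /\ count negb D = n.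
Proof.
case: DyckD => sD h0 _; move: h0; rewrite /height -sD take_size.
have := count_predC id D; rewrite sD.
have -> : count (predC id) D = count negb D by apply: eq_count.
by lia.
Qed.

Lemma size_stepsE :
  size (up_steps D) = n /\ size (down_steps D) = n.
Proof.
have [cu cd] := count_up.
have E (a : pred bool) : count a D = count (fun p => a (nth false D p)) (iota 0 (size D)).
  by rewrite -{1}(mkseq_nth false D) /mkseq count_map.
by rewrite !size_filter; split; [rewrite -[RHS]cu E | rewrite -[RHS]cd E].
Qed.

Lemma match_stepP p : p < size D -> nth false D p ->
  let q := match_step D p in
  [/\ p < q, q < size D, ~~ nth false D q, height D q.+1 = height D p
    & forall r, p < r <= q -> (height D p < height D r)%R].
Proof.
move=> ltp up q; case: DyckD => sD h0 hge.
have ex : exists k, (p < k <= size D) && (height D k <= height D p)%R.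
  by exists (size D); rewrite ltp leqnn /= sD h0 hge.
case: (ex_minnP ex) => k /andP[/andP[ltpk lekD] hk] kmin.
have hp1 := heightS ltp; rewrite up in hp1.
have ltpk1 : p.+1 < k.
  by move: hk; case: (ltngtP p.+1 k) ltpk => // <- _; lia.
case: k => [//|k] in ltpk lekD hk kmin ltpk1 *.
have hk' : (height D p < height D k)%R.
  have := kmin k; case: (leP (height D k) (height D p)) => // _.
  by rewrite andbT => /(_ _); lia.
have hS := heightS lekD.
have [dk hkE] : ~~ nth false D k /\ height D k.+1 = height D p.
  by move: hS; case: (nth _ _ _) => hS; split => //; lia.
pose P q := [&& p < q, ~~ nth false D q & height D q.+1 == height D p].
have Pk : P k by rewrite /P dk hkE eqxx andbT /=; lia.
have hasP : has P (iota 0 (size D)).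
  by apply/hasP; exists k => //; rewrite mem_iota.
have ltq : q < size D by have := hasP; rewrite has_find size_iota.
have := nth_find 0 hasP; rewrite -/(match_step D p) -/q nth_iota // add0n.
move=> /and3P[pq dq /eqP hq]; split=> //.
have qk : q <= k.
  rewrite leqNgt; apply/negP => kq.
  have := before_find 0 kq; rewrite nth_iota ?add0n; last by lia.
  by rewrite -/(P k) Pk.
move=> r /andP[pr rq]; case: (ltP (height D p) (height D r)) => // hr.
by have := kmin r; rewrite hr andbT => /(_ _); lia.
Qed.

Lemma nth_up i : i < n ->
  let p := nth 0 (rev (up_steps D)) i in p < size D /\ nth false D p.
Proof.
move=> lti p; have [su _] := size_stepsE.
have : p \in rev (up_steps D) by rewrite mem_nth // size_rev su.
by rewrite mem_rev mem_filter mem_iota => /andP[-> /andP[_]].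
Qed.

Lemma Phi_inv_label_lt i : i < n -> Phi_inv_label D i < n.
Proof.
move=> lti; have [ltp up] := nth_up lti; have [_ sd] := size_stepsE.
have [_ ltq dq _ _] := match_stepP ltp up.
rewrite /Phi_inv_label -[X in _ < X]sd index_mem mem_filter mem_iota.
by rewrite dq.
Qed.

Lemma match_step_inj p q : p < size D -> nth false D p ->
  q < size D -> nth false D q -> match_step D p = match_step D q -> p = q.
Proof.
wlog lepq : p q / p <= q => [hw | ltp up ltq uq E].
  by case: (leqP p q) => [/hw //|/ltnW /hw h *]; apply/esym/h.
have [_ _ _ hp hmin] := match_stepP ltp up.
have [qm _ _ hq _] := match_stepP ltq uq.
case: (ltngtP p q) lepq => // pq _.
by have := hmin q; rewrite -hp E hq => /(_ _); lia.
Qed.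

Lemma Phi_inv_label_inj i j : i < n -> j < n ->
  Phi_inv_label D i = Phi_inv_label D j -> i = j.
Proof.
move=> lti ltj; have [ltp up] := nth_up lti; have [ltq uq] := nth_up ltj.
have [su sd] := size_stepsE.
have inD p : p < size D -> nth false D p -> match_step D p \in down_steps D.
  move=> lp u; have [_ l d _ _] := match_stepP lp u.
  by rewrite mem_filter mem_iota d.
move=> /(index_inj 0 (inD _ ltp up) (inD _ ltq uq)) /(match_step_inj ltp up ltq uq) /eqP.
rewrite nth_uniq ?size_rev ?su // => [/eqP //|].
by rewrite rev_uniq filter_uniq // iota_uniq.
Qed.

Lemma Phi_invE (i : 'I_n) : Phi_inv n D i = Phi_inv_label D i :> nat.
Proof.
have E (k : 'I_n) : insubd k (Phi_inv_label D k) = Phi_inv_label D k :> nat.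
  by rewrite val_insubd Phi_inv_label_lt.
have inj : injectiveb [ffun k : 'I_n => insubd k (Phi_inv_label D k)].
  apply/injectiveP => k l; rewrite !ffunE => /(congr1 val) /=.
  by rewrite !E => /Phi_inv_label_inj h; apply/val_inj/h.
by rewrite -pvalE /Phi_inv insubdK // ffunE E.
Qed.

End PhiInv.

Section PsiDyck.

Local Notation row T k := (nth [::] T k).
Local Notation below v := (fun y : nat => y < v).

Lemma row_insert_append m x T : size T <= m.+1 ->
  {in row T 0, forall y, y <= x} ->
  exists T', [/\ row_insert x T = (T', 0), size T' <= m.+1,
    row T' 0 = rcons (row T 0) x & forall k, row T' k.+1 = row T k.+1].
Proof.
case: T => [|r T] sT hx.
  by exists [:: [:: x]]; split=> // k; rewrite /= nth_nil.
exists (rcons r x :: T); split => //=; case: ifP => //.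
by rewrite -has_find => /hasP[y /hx] /=; lia.
Qed.

Lemma row_insert_bump x T : size T <= 2 ->
  let r := row T 0 in let k := find (fun y => x < y) r in let y := nth 0 r k in
  k < size r -> {in row T 1, forall z, z <= y} ->
  exists T', [/\ row_insert x T = (T', 1), size T' <= 2,
    row T' 0 = set_nth 0 r k x & row T' 1 = rcons (row T 1) y].
Proof.
case: T => [|r T] //= sT ltk hy; rewrite ltk.
have [//|//|T' [-> sT' r0 _]] :=
  @row_insert_append 0 (nth 0 r (find (fun y => x < y) r)) T.
by exists (set_nth 0 r (find (fun y => x < y) r) x :: T').
Qed.

Lemma RSK_rcons w x : RSK (rcons w x) = rsk_step (RSK w) (size w, x).
Proof.
rewrite /RSK size_rcons -addn1 iotaD cats1 add0n zip_rcons ?size_iota //.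
by rewrite foldl_rcons.
Qed.

Definition lower (w : seq nat) (y : nat) :=
  exists i j, [/\ i < j < size w, nth 0 w j < nth 0 w i & y <= nth 0 w j].

Definition free321 (w : seq nat) := forall i j k,
  i < j -> j < k -> k < size w -> nth 0 w k < nth 0 w j -> nth 0 w j < nth 0 w i ->
  False.

Record rsk_inv (w : seq nat) (P Q : seq (seq nat)) : Prop := RskInv {
  inv_size : size P <= 2;
  inv_sorted : sorted ltn (row P 0);
  inv_perm : perm_eq (row P 0 ++ row P 1) w;
  inv_lower : forall y z, y \in row P 0 -> z \in row P 1 -> y < z -> lower w y;
  inv_ballotP : forall v, count (below v) (row P 1) <= count (below v) (row P 0);
  inv_permQ : perm_eq (row Q 0 ++ row Q 1) (iota 0 (size w));
  inv_shape0 : size (row Q 0) = size (row P 0);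
  inv_shape1 : size (row Q 1) = size (row P 1);
  inv_ballotQ : forall v, count (below v) (row Q 1) <= count (below v) (row Q 0)
}.

Lemma lower_rcons w x y : lower w y -> lower (rcons w x) y.
Proof.
move=> [i [j [/andP[ij jw] h1 h2]]]; exists i, j; rewrite size_rcons !nth_rcons.
by rewrite jw (ltn_trans ij jw) ij /= ltnS (ltnW jw).
Qed.

Lemma lower_last w x z : z \in w -> x < z -> lower (rcons w x) x.
Proof.
move=> zw xz; exists (index z w), (size w).
by rewrite size_rcons !nth_rcons index_mem zw ltnn eqxx nth_index //= ltnSn.
Qed.

Lemma rsk_invP w : uniq w -> free321 w -> rsk_inv w (RSK w).1 (RSK w).2.
Proof.
elim/last_ind: w => [|w x IH] uw fw; first by split.
rewrite rcons_uniq in uw; case/andP: uw => xw uw.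
have fw' : free321 w.
  move=> i j k ij jk kw h1 h2; apply: (fw i j k ij jk).
  - by rewrite size_rcons; lia.
  - by rewrite !nth_rcons kw (ltn_trans jk kw).
  - by rewrite !nth_rcons (ltn_trans jk kw) (ltn_trans ij (ltn_trans jk kw)).
rewrite RSK_rcons; case: {IH}(RSK w) (IH uw fw') => P Q /= [].
rewrite /rsk_step /=; set r0 := row P 0; set r1 := row P 1.
set q0 := row Q 0; set q1 := row Q 1.
move=> sP so pm lo bP pQ s0 s1 bQ.
have mw y : (y \in w) = (y \in r0) || (y \in r1).
  by rewrite -(perm_mem pm) mem_cat.
have xr0 : x \notin r0 by apply: contra xw; rewrite mw => ->.
have qlt v (r : seq nat) : {subset r <= q0 ++ q1} -> size w < v ->
    count (below v) r = size r.
  move=> sr hv; apply/eqP; rewrite -all_count; apply/allP => y /sr.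
  by rewrite (perm_mem pQ) mem_iota => yw; apply: ltn_trans hv.
have c1 v : size w < v -> count (below v) q1 = size q1.
  by apply: qlt => y yq; rewrite mem_cat yq orbT.
have c0 v : size w < v -> count (below v) q0 = size q0.
  by apply: qlt => y yq; rewrite mem_cat yq.
pose k := find (fun y => x < y) r0.
case: (ltnP k (size r0)) => hk; last first.
  have hx : {in r0, forall y, y < x}.
    move=> y yr; rewrite ltn_neqAle [y <= x]leqNgt; apply/andP; split.
      by apply: contraNneq xr0 => <-.
    apply/negP => xy; move: hk; rewrite leqNgt -has_find => /hasPn /(_ _ yr).
    by rewrite xy.
  have [y /hx /ltnW //|T' [-> sT' E0 E1]] := @row_insert_append 1 x P sP.
  split=> //; rewrite ?E0 ?E1 ?nth_set_nth /= -/r0 -/r1 -/q0 -/q1.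
  - by case: r0 so hx {xr0 hk E0 s0 bP k mw lo pm} => [//|a r] /= so hx;
      rewrite rcons_path so; apply: hx; apply: mem_last.
  - by rewrite cat_rcons perm_sym perm_rcons perm_sym -cat1s perm_catCA /= perm_cons.
  - move=> y z; rewrite mem_rcons inE => /orP[/eqP->|yr] zr yz.
      by apply: lower_last yz; rewrite mw zr orbT.
    by apply/lower_rcons/(lo y z).
  - by move=> v; rewrite -cats1 count_cat; have := bP v; lia.
  - rewrite size_rcons -addn1 iotaD add0n cat_rcons -cat1s perm_catCA.
    by rewrite perm_sym perm_catC /= perm_cons perm_sym.
  - by rewrite !size_rcons s0.
  - by [].
  - by move=> v; rewrite -cats1 count_cat; have := bQ v; lia.
set y := nth 0 r0 k.
have xy : x < y by apply: (nth_find 0); rewrite has_find.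
have yr0 : y \in r0 by rewrite mem_nth.
have yw : y \in w by rewrite mw yr0.
have hy : {in r1, forall z, z < y}.
  move=> z zr; rewrite ltnNge; apply/negP => yz.
  have ur : uniq (r0 ++ r1) by rewrite (perm_uniq pm).
  have yz' : y < z.
    rewrite ltn_neqAle yz andbT; apply/eqP => E.
    by move: ur; rewrite cat_uniq => /and3P[_ /hasPn /(_ _ zr)]; rewrite -E yr0.
  have [i [j [/andP[ij jw] h1 h2]]] := lo y z yr0 zr yz'.
  have iw := ltn_trans ij jw.
  by apply: (fw i j (size w)) => //; rewrite ?size_rcons ?nth_rcons ?iw ?jw
    ?ltnn ?eqxx //; lia.
have [|T' [-> sT' E0 E1]] := @row_insert_bump x P sP hk.
  by move=> z /hy /ltnW.
rewrite -/r0 -/r1 -/k -/y in E0 E1.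
have Er : r0 = take k r0 ++ y :: drop k.+1 r0.
  by rewrite -drop_nth // cat_take_drop.
have Es : set_nth 0 r0 k x = take k r0 ++ x :: drop k.+1 r0.
  by rewrite set_nthE hk.
have tx : {in take k r0, forall z, z < x}.
  move=> z zt; have /(nthP 0) [i] := zt; rewrite size_take hk => ik.
  rewrite nth_take // => Ez.
  have := before_find 0 ik; rewrite Ez => /negbT.
  rewrite -leqNgt leq_eqVlt => /orP[/eqP E|//].
  by move: xr0; rewrite -E (mem_take zt).
have dy : {in drop k.+1 r0, forall z, y < z}.
  move=> z zd; move: so; rewrite (sorted_pairwise ltn_trans) Er pairwise_cat.
  by move=> /and3P[_ _] /= /andP[/allP /(_ _ zd)].
have Ec a : count a r0 = count a (take k r0) + (a y + count a (drop k.+1 r0)).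
  by rewrite {1}Er count_cat.
have cr v : count (below v) (set_nth 0 r0 k x) + (y < v) =
            count (below v) r0 + (x < v).
  by rewrite Es Ec !count_cat /=; lia.
split=> //; rewrite ?E0 ?E1 ?nth_set_nth /= -/r0 -/r1 -/q0 -/q1.
- move: so; rewrite Es {1}Er !(sorted_pairwise ltn_trans) !pairwise_cat.
  rewrite !allrel_consr /= => /and3P[/andP[_ a1] a2 /andP[_ a3]].
  rewrite a1 a2 a3 !andbT /=; apply/andP; split.
    by apply/allP => z /tx.
  by apply/allP => z /dy; apply: ltn_trans.
- apply/seq.permP => a; rewrite Es -!cats1 !count_cat /=.
  by rewrite -(seq.permP pm a) count_cat Ec /=; lia.
- move=> u z uu; rewrite mem_rcons inE.
  have {uu} : u \in x :: r0.
    move: uu; rewrite Es inE mem_cat inE => /or3P[/mem_take->|->//|/mem_drop->];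
    by rewrite orbT.
  rewrite inE => /orP[/eqP -> _ _|ur]; first exact: lower_last xy.
  case/orP=> [/eqP -> uy|zr uz]; last by apply/lower_rcons/(lo u z).
  have [i [j [a b c]]] := lower_last yw xy; exists i, j; split=> //.
  suff ux : u < x by apply: leq_trans c; apply: ltnW.
  move: ur; rewrite Er mem_cat inE => /or3P[/tx //|/eqP Eu|/dy]; lia.
- move=> v; rewrite -cats1 count_cat /=; have := bP v; have := cr v.
  case: (ltnP y v) => yv /=; last by lia.
  have -> : count (below v) r1 = count (below y) r1.
    by apply: eq_in_count => z /hy /=; lia.
  have : count (below y) r0 < count (below v) r0.
    have sub r : count (below y) r <= count (below v) r.
      by apply: sub_count => z /= /ltn_trans; apply.
    rewrite !Ec ltnn yv.
    by have := sub (take k r0); have := sub (drop k.+1 r0); lia.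
  by have := bP y; lia.
- rewrite size_rcons -addn1 iotaD add0n -rcons_cat -cats1.
  by rewrite perm_cat2r.
- by rewrite s0 Es {1}Er !size_cat.
- by rewrite !size_rcons s1.
- move=> v; rewrite -cats1 count_cat /=; have := bQ v.
  case: (ltnP (size w) v) => hv /=; last by lia.
  rewrite c1 // c0 // s0 s1 => _.
  have : count (below y) r0 < size r0.
    rewrite Er count_cat /= ltnn size_cat /=.
    by have := count_size (below y) (take k r0);
       have := count_size (below y) (drop k.+1 r0); lia.
  have := bP y; suff -> : count (below y) r1 = size r1 by lia.
  by apply/eqP; rewrite -all_count; apply/allP.
Qed.

Lemma size_word n (s : 'S_n) : size (word s) = n.
Proof. by rewrite size_map size_enum_ord. Qed.

Lemma nth_word n (s : 'S_n) (i : 'I_n) : nth 0 (word s) i = s i.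
Proof. by rewrite (nth_map i) ?size_enum_ord // nth_ord_enum. Qed.

Lemma perm_word n (s : 'S_n) : perm_eq (word s) (iota 0 n).
Proof.
apply: uniq_perm; rewrite ?iota_uniq //.
  by rewrite map_inj_uniq ?enum_uniq // => i j /val_inj /perm_inj.
move=> y; rewrite mem_iota /= add0n; apply/mapP/idP => [[i _ ->] // | lty].
by exists ((s^-1)%g (Ordinal lty)); rewrite ?mem_enum // permKV.
Qed.

Lemma free321_word n (s : 'S_n) : s \in Av n [:: 3; 2; 1] -> free321 (word s).
Proof.
rewrite inE => /negP av i j k ij jk; rewrite size_word => kn.
have jn := ltn_trans jk kn; have in_ := ltn_trans ij jn.
rewrite (nth_word s (Ordinal kn)) (nth_word s (Ordinal jn)).
rewrite (nth_word s (Ordinal in_)) => h1 h2; apply: av; apply/existsP.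
exists [ffun t : 'I_3 => nth (Ordinal kn) [:: Ordinal in_; Ordinal jn] t].
apply/forallP => -[[|[|[|//]]] ha]; apply/forallP => -[[|[|[|//]]] hb].
all: by rewrite !ffunE /=; lia.
Qed.

Lemma count_mem_iota (r : seq nat) k : uniq r ->
  count [in r] (iota 0 k) = count (below k) r.
Proof.
move=> ur; rewrite -!size_filter; apply/perm_size/uniq_perm.
- by rewrite filter_uniq ?iota_uniq.
- by rewrite filter_uniq.
- by move=> y; rewrite !mem_filter mem_iota add0n /= andbC.
Qed.

Lemma Psi_Dyck n (s : 'S_n) : s \in Av n [:: 3; 2; 1] -> Dyck n (Psi s).
Proof.
move=> /free321_word fs.
have uw : uniq (word s) by rewrite (perm_uniq (perm_word s)) iota_uniq.
case: (rsk_invP uw fs); rewrite /Psi size_word.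
case: (RSK _) => P Q /=; set r0 := row P 0; set r1 := row P 1.
set q0 := row Q 0; set q1 := row Q 1 => _ _ pP _ bP pQ s0 s1 bQ.
have {}pP := perm_trans pP (perm_word s).
have part a b : perm_eq (a ++ b) (iota 0 n) ->
  [/\ uniq a, uniq b, forall y, y < n -> (y \notin a) = (y \in b),
      count (below n) a = size a & count (below n) b = size b].
  move=> pm; have : uniq (a ++ b) by rewrite (perm_uniq pm) iota_uniq.
  rewrite cat_uniq => /and3P[ua /hasPn hab ub]; split=> //.
  - move=> y yn; have : y \in a ++ b by rewrite (perm_mem pm) mem_iota.
    by rewrite mem_cat; case: (boolP (y \in b)) => [/hab //|]; rewrite orbF => _ ->.
  - apply/eqP; rewrite -all_count; apply/allP => y ya.
    by have := perm_mem pm y; rewrite mem_cat ya mem_iota => /esym /andP[].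
  - apply/eqP; rewrite -all_count; apply/allP => y yb.
    by have := perm_mem pm y; rewrite mem_cat yb orbT mem_iota => /esym /andP[].
have [u0 u1 r01 c0 c1] := part _ _ pP.
have [v0 v1 q01 d0 d1] := part _ _ pQ.
have sr : size r0 + size r1 = n by rewrite -size_cat (perm_size pP) size_iota.
set D := _ ++ _.
have sD : size D = n.*2 by rewrite size_cat !size_map size_rev size_iota addnn.
have h1 k : k <= n ->
    height D k = ((count (below k) r0)%:Z - (count (below k) r1)%:Z)%R.
  move=> kn; rewrite /height /D takel_cat ?size_map ?size_iota //.
  rewrite -map_take take_iota (minn_idPl kn) !count_map -!count_mem_iota //.
  congr (_%:Z - _%:Z)%R; apply: eq_in_count => y; rewrite mem_iota /= => yk.
  by apply: r01; lia.
have h2 m : m <= n -> height D (n.*2 - m) =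
    ((count (below m) q0)%:Z - (count (below m) q1)%:Z)%R.
  move=> mn.
  have cut a : count a (iota m (n - m)) = count a (iota 0 n) - count a (iota 0 m).
    by rewrite -{2}(subnKC mn) iotaD add0n count_cat; lia.
  have mono r : count (below m) r <= count (below n) r.
    by apply: sub_count => y /= ym; apply: leq_trans mn.
  have tD : take (n.*2 - m) D = [seq i \in r0 | i <- iota 0 n] ++
      [seq j \in q1 | j <- rev (iota m (n - m))].
    rewrite /D take_cat size_map size_iota ltnNge.
    rewrite (_ : n <= n.*2 - m) /=; last by lia.
    rewrite -map_take (_ : n.*2 - m - n = n - m); last by lia.
    by rewrite take_rev size_iota drop_iota subKn.
  rewrite /height tD !count_cat !count_map !count_rev.
  have -> : count (preim (mem r0) negb) (iota 0 n) = size r1.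
    rewrite -[RHS]c1 -count_mem_iota //; apply: eq_in_count => y.
    by rewrite mem_iota => /r01.
  have -> : count (preim (mem q1) negb) (iota m (n - m)) =
            count [in q0] (iota m (n - m)).
    apply: eq_in_count => y; rewrite mem_iota /= => yn; rewrite -q01 ?negbK //.
    by lia.
  have -> : count (preim (mem r0) id) (iota 0 n) = size r0.
    by rewrite -[RHS]c0 -count_mem_iota.
  have -> : count (preim (mem q1) id) (iota m (n - m)) =
            count [in q1] (iota m (n - m)) by [].
  rewrite !cut !count_mem_iota // d0 d1.
  by have := mono q0; have := mono q1; rewrite d0 d1 s0 s1; lia.
have hend : height D n.*2 = 0%R.
  by have := h2 0 (leq0n n); rewrite subn0 => ->; rewrite -!count_mem_iota.
split=> // k; case: (leqP k n) => [kn|nk]; first by rewrite h1 //; have := bP k; lia.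
case: (leqP k n.*2) => [k2|k2].
  by rewrite -(subKn k2) h2; [have := bQ (n.*2 - k); lia | lia].
suff -> : height D k = height D n.*2 by rewrite hend.
by rewrite /height !take_oversize ?sD // ltnW.
Qed.

End PsiDyck.

Lemma ThetaE n (s : 'S_n) (i : 'I_n) : s \in Av n [:: 3; 2; 1] ->
  Theta s i = Phi_inv_label (Psi s) i :> nat.
Proof. by move=> /Psi_Dyck DP; apply: Phi_invE. Qed.

(* Main.v *)
Require Import Defs.
From mathcomp Require Import all_boot all_order ssralg ssrnum ssrint fingroup perm zify.

(* For every permutation s, counting for each k the arcs i -> s i that pass over
   k shows that crs s + exc s is the number of inversions of s that go from an
   excedance to a non-excedance, minus the number of inversions between entries
   of the same type.

   If s avoids 321, every inversion goes from an excedance to a non-excedance,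
   and RSK matches some excedances (the bumped letters, whose values form the
   second row of P) with some non-excedances (the bumping letters, whose
   positions form the second row of Q). Every inversion involves a matched
   entry, so the unmatched entries form an increasing sequence.

   For pi = Theta s, the entries of pi are the arcs (tunnels) of the path Psi s.
   The sign of pi i - i tells on which side of the middle the centre of the arc
   lies, and the inversions are the pairs of disjoint arcs. The path reaches
   height at least r after step k of either half if r unmatched entries have
   value (in the left half) or position (in the right half, read backwards)
   below k, with equality at unmatched excedances, respectively
   non-excedances. Comparing heights, an unmatched excedance of value v starts
   at step v of the left half an arc with centre to the right of the middle,
   and an unmatched non-excedance ends at the mirror image of its position an
   arc with centre to the left of the middle, or in the middle if it is a fixed
   point. A count shows that these are all the arcs joining the two halves,
   which settles fp and exc. For crs, the inversions of s and the signed count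
   of the inversions of pi are both computed by comparing entries with the
   matched letters, and give the same formula. *)

Set Implicit Arguments.
Unset Strict Implicit.
Unset Printing Implicit Defensive.

Import Order.TTheory.

(** * Counting *)

Lemma card_set_sum (T : finType) (P : pred T) : #|[set x | P x]| = \sum_x P x.
Proof. by rewrite -sum1dep_card big_mkcond; apply: eq_bigr => x _; case: (P x). Qed.

Lemma sum_ord_itv n a b : b <= n -> \sum_(k < n) (a <= k < b) = b - a.
Proof.
move=> bn; suff -> : \sum_(k < n) (a <= k < b) = minn n b - a by rewrite (minn_idPr bn).
elim: n {bn} => [|n IH]; first by rewrite big_ord0 min0n.
by rewrite big_ord_recr /= IH; lia.
Qed.

Lemma sum_ord_lt n b : b <= n -> \sum_(k < n) (k < b) = b.
Proof. by move=> bn; rewrite -[RHS]subn0 -(sum_ord_itv 0 bn). Qed.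

Lemma sum_eq1 (T : finType) (x : T) : \sum_y (y == x) = 1.
Proof. by rewrite (bigD1 x) //= eqxx big1 // => y /negbTE ->. Qed.

Lemma sum_codom (S T : finType) (g : S -> T) (F : T -> nat) : injective g ->
  \sum_(x in codom g) F x = \sum_y F (g y).
Proof.
by move=> /injectiveP inj_g; rewrite -big_uniq // codomE big_map big_enum.
Qed.

Lemma sum_notin_codom (S T : finType) (g : S -> T) (F : T -> nat) : injective g ->
  \sum_x F x = \sum_y F (g y) + \sum_(x | x \notin codom g) F x.
Proof. by move=> inj_g; rewrite (bigID [in codom g]) sum_codom. Qed.

Lemma eq_of_leq_sum (T : finType) (P : pred T) (F G : T -> nat) :
  (forall x, P x -> F x <= G x) -> \sum_(x | P x) G x <= \sum_(x | P x) F x ->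
  forall x, P x -> F x = G x.
Proof.
move=> leFG leGF x Px; have [le_sum eq_sum] := leqif_sum (fun x Px => leqif_eq (leFG x Px)).
by move: eq_sum; rewrite eqn_leq le_sum leGF => /esym/forall_inP/(_ x Px)/eqP.
Qed.

Lemma sum_cond_sum (S T : finType) (P : pred S) (r : S -> T -> bool) :
  \sum_(x | P x) \sum_y r x y = \sum_x \sum_y (P x && r x y).
Proof.
by rewrite big_mkcond; apply: eq_bigr => x _; case: (P x) => //=; rewrite big1.
Qed.

Section Prefixes.

Variables (T : Type) (x0 : T) (a : pred T) (s : seq T).

Lemma count_takeS k : k < size s ->
  count a (take k.+1 s) = count a (take k s) + a (nth x0 s k).
Proof. by move=> ks; rewrite (take_nth x0) // -cats1 count_cat /= addn0. Qed.

Lemma leq_count_take : {homo (fun k => count a (take k s)) : k l / k <= l}.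
Proof. by move=> k l kl; rewrite -(subnKC kl) takeD count_cat leq_addr. Qed.

Lemma ltn_count_take k l : k < size s -> a (nth x0 s k) ->
  (count a (take k s) < count a (take l s)) = (k < l).
Proof.
move=> ks ak; apply/idP/idP => [|kl].
  by rewrite ltnNge; apply: contraNT; rewrite -leqNgt => /leq_count_take.
by apply: leq_trans (leq_count_take kl); rewrite count_takeS // ak addn1.
Qed.

Lemma count_take_rev k : k <= size s ->
  count a (take (size s - k) s) + count a (take k (rev s)) = count a s.
Proof. by move=> ks; rewrite take_rev count_rev -count_cat cat_take_drop. Qed.

Lemma count_take_sum k : k <= size s ->
  count a (take k s) = \sum_(u < k) a (nth x0 s u).
Proof.
elim: k => [|k IH] ks; first by rewrite take0 big_ord0.
by rewrite count_takeS // IH 1?ltnW // big_ord_recr.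
Qed.

Lemma index_filter_nth k : k < size s -> a (nth x0 s k) ->
  index k [seq l <- iota 0 (size s) | a (nth x0 s l)] = count a (take k s).
Proof.
move=> ks ak; rewrite -(subnKC (ltnW ks)) iotaD filter_cat index_cat.
rewrite mem_filter mem_iota /= add0n ltnn andbF size_filter.
have -> : size s - k = (size s - k).-1.+1 by lia.
by rewrite /= ak /= eqxx addn0 -(map_nth_iota0 x0 (ltnW ks)) count_map.
Qed.

End Prefixes.

(** * Crossings and inversions *)

Section Inversions.

Variables (n : nat) (s : 'S_n).

Lemma sum_perm (F : 'I_n -> nat) : \sum_i F (s i) = \sum_i F i.
Proof. by rewrite [RHS](reindex_inj (@perm_inj _ s)). Qed.

Lemma sum_perm_lt v : v <= n -> \sum_(i < n) (s i < v) = v.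
Proof. by move=> vn; rewrite (sum_perm (fun x => (x < v) : nat)) sum_ord_lt. Qed.

Lemma val_perm_inj (i j : 'I_n) : s i = s j :> nat -> i = j.
Proof. by move/val_inj/perm_inj. Qed.

Lemma val_perm_neq (i j : 'I_n) : i != j :> nat -> s i != s j :> nat.
Proof. by apply: contraNneq => /val_perm_inj ->. Qed.

Definition excedance (i : 'I_n) := i < s i.
Definition nonexcedance (i : 'I_n) := s i <= i.

Definition inversion (i j : 'I_n) := (i < j) && (s j < s i).

Definition inversions (P Q : pred 'I_n) :=
  \sum_(i < n) \sum_(j < n) [&& inversion i j, P i & Q j].

Lemma nonexcedanceN i : nonexcedance i = ~~ excedance i.
Proof. exact: leqNgt. Qed.

Lemma excedanceN i : excedance i = ~~ nonexcedance i.
Proof. exact: ltnNge. Qed.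

Lemma exc_sum : exc s = \sum_i excedance i.
Proof. exact: card_set_sum. Qed.

Lemma sum_upper_lower_arcs k :
  \sum_(j < n) (s j <= k < j) = \sum_(j < n) (j <= k < s j).
Proof.
have := sum_perm (fun j => (j <= k) : nat).
have -> : \sum_(i < n) (s i <= k) =
    \sum_(i < n) ((i <= k) && (s i <= k)) + \sum_(i < n) (s i <= k < i).
  by rewrite -big_split; apply: eq_bigr => i _ /=; lia.
have -> : \sum_(i < n) (i <= k) =
    \sum_(i < n) ((i <= k) && (s i <= k)) + \sum_(i < n) (i <= k < s i).
  by rewrite -big_split; apply: eq_bigr => i _ /=; lia.
by move/addnI.
Qed.

Lemma crs_monochromatic_inversions :
  crs s + inversions excedance excedance + inversions nonexcedance nonexcedance =
  \sum_(j < n) \sum_(i < n) [&& j < s j, i < j & j < s i] +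
  \sum_(i < n) \sum_(j < n) [&& s i <= i, s j <= i & i < j].
Proof.
have -> : crs s = \sum_(i < n) \sum_(j < n) crossing s i j.
  by rewrite /crs card_set_sum pair_big.
rewrite [X in _ = X + _]exchange_big -!big_split; apply: eq_bigr => i _.
rewrite -!big_split; apply: eq_bigr => j _ /=.
rewrite /crossing /inversion /excedance /nonexcedance.
by have := @val_perm_neq i j; lia.
Qed.

(* Both sides count the pairs of an index k and an arc i -> s i above the axis
   passing over k; the subtraction is truncated, so that only excedances
   contribute. *)
Lemma crs_exc_displacement : crs s + exc s +
  inversions excedance excedance + inversions nonexcedance nonexcedance =
  \sum_(i < n) (s i - i).
Proof.
have -> : \sum_(i < n) (s i - i) = \sum_(k < n) \sum_(i < n) (i <= k < s i).
  by rewrite exchange_big; apply: eq_bigr => i _; rewrite -(@sum_ord_itv n) // ltnW.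
transitivity (exc s + (crs s + inversions excedance excedance +
    inversions nonexcedance nonexcedance)); first by lia.
rewrite crs_monochromatic_inversions exc_sum -!big_split /=.
apply: eq_bigr => k _; rewrite /excedance; case: (ltnP k (s k)) => exc_k /=.
  rewrite [X in _ + (_ + X)]big1 // addn0 [in RHS](bigD1 k) //= leqnn exc_k.
  rewrite [in LHS](bigD1 k) //= ltnn add0n; congr (_ + _).
  by apply: eq_bigr => i ik; rewrite [in RHS]leq_eqVlt (negbTE (ik : i != k :> nat)).
by rewrite add0n [X in X + _]big1 // sum_upper_lower_arcs.
Qed.

(* s i - i is the number of smaller values after position i minus the number of
   greater values before it, which belong to excedances if i does. *)
Lemma displacement_inversions :
  \sum_(i < n) (s i - i) = inversions excedance nonexcedance.
Proof.
apply/eqP; rewrite -(eqn_add2r (inversions excedance excedance)).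
rewrite {1}/inversions exchange_big /inversions -!big_split; apply/eqP.
apply: eq_bigr => i _ /=; rewrite /inversion /excedance /nonexcedance.
case: (ltnP i (s i)) => exc_i; last first.
  rewrite (_ : s i - i = 0) ?add0n; last by lia.
  by rewrite -!big_split !big1 // => j _ /=; lia.
have smaller_indices : \sum_(j < n) ((j < i) && (s i < s j)) +
    \sum_(j < n) ((j < i) && (s j < s i)) = i.
  rewrite -[RHS](@sum_ord_lt n i) 1?ltnW // -big_split; apply: eq_bigr => j _ /=.
  by have := @val_perm_neq i j; lia.
have smaller_values : \sum_(j < n) ((i < j) && (s j < s i)) +
    \sum_(j < n) ((j < i) && (s j < s i)) = s i.
  rewrite -[RHS](@sum_perm_lt (s i)) 1?ltnW // -big_split; apply: eq_bigr => j _ /=.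
  by case: (ltngtP i j) => [_|_|E] /=; rewrite ?addn0 // (val_inj E) ltnn.
have -> : \sum_(j < n) [&& (j < i) && (s i < s j), j < s j & true] =
    \sum_(j < n) ((j < i) && (s i < s j)).
  by apply: eq_bigr => j _; lia.
have -> : \sum_(j < n) [&& (i < j) && (s j < s i), true & s j <= j] +
    \sum_(j < n) [&& (i < j) && (s j < s i), true & j < s j] =
    \sum_(j < n) ((i < j) && (s j < s i)).
  by rewrite -big_split; apply: eq_bigr => j _ /=; lia.
lia.
Qed.

Lemma crs_exc_inversions : crs s + exc s +
  inversions excedance excedance + inversions nonexcedance nonexcedance =
  inversions excedance nonexcedance.
Proof. by rewrite crs_exc_displacement displacement_inversions. Qed.

End Inversions.

Definition perm_avoids321 n (s : 'S_n) := forall i j k : 'I_n,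
  i < j -> j < k -> ~ (s k < s j < s i).

Lemma perm_avoids321_inv n (s : 'S_n) : perm_avoids321 s -> perm_avoids321 s^-1%g.
Proof.
move=> s_avoids i j k ij jk /andP[kj ji]; apply: (s_avoids _ _ _ kj ji).
by rewrite !permKV ij jk.
Qed.

Lemma inversion_inv n (s : 'S_n) (i j : 'I_n) :
  inversion s^-1%g (s j) (s i) = inversion s i j.
Proof. by rewrite /inversion !permK andbC. Qed.

Lemma inversion_excedance n (s : 'S_n) (i j : 'I_n) : perm_avoids321 s ->
  inversion s i j -> excedance s i.
Proof.
move=> s_avoids /andP[ij sji]; rewrite /excedance.
rewrite -[X in _ <= X](sum_perm_lt s (ltnW (ltn_ord (s i)))).
rewrite -(sum_ord_lt (ltnW (ltn_ord i))) -addn1 -(sum_eq1 j) -big_split.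
apply: leq_sum => k _ /=; case: (eqVneq k j) => [->|_]; first by rewrite sji; lia.
have := @val_perm_neq n s k i; case: (ltnP k i) => ki //=.
by have := s_avoids _ _ _ ki ij; rewrite sji; lia.
Qed.

Section Inversions321.

Variables (n : nat) (s : 'S_n).
Hypothesis s_avoids : perm_avoids321 s.

Lemma inversion_lt i j : inversion s i j -> s j < j.
Proof.
rewrite -inversion_inv => /(inversion_excedance (perm_avoids321_inv s_avoids)).
by rewrite /excedance permK.
Qed.

Lemma inversion_nonexcedance i j : inversion s i j -> nonexcedance s j.
Proof. by move/inversion_lt/ltnW. Qed.

Lemma crs_exc_avoids321 : crs s + exc s = \sum_(i < n) \sum_(j < n) inversion s i j.
Proof.
have no_EE : inversions s (excedance s) (excedance s) = 0.
  apply: big1 => i _; apply: big1 => j _; case: (boolP (inversion s i j)) => //=.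
  by move/inversion_lt; rewrite /excedance; lia.
have no_NN : inversions s (nonexcedance s) (nonexcedance s) = 0.
  apply: big1 => i _; apply: big1 => j _; case: (boolP (inversion s i j)) => //=.
  by move/(inversion_excedance s_avoids); rewrite /excedance /nonexcedance; lia.
have := crs_exc_inversions s; rewrite no_EE no_NN !addn0 => ->.
apply: eq_bigr => i _; apply: eq_bigr => j _; case: (boolP (inversion s i j)) => //= inv.
by rewrite (inversion_excedance s_avoids inv) (inversion_nonexcedance inv).
Qed.

End Inversions321.

(** * Arcs of a Dyck path *)

Section Arcs.

Local Notation ups D k := (count id (take k D)).
Local Notation downs D k := (count negb (take k D)).

Lemma ups_downs D k : k <= size D -> ups D k + downs D k = k.
Proof.
move=> kD; rewrite -[RHS](size_takel kD) -(count_predC id (take k D)).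
by congr (_ + _); apply: eq_count.
Qed.

Definition arc_start (D : seq bool) (i : nat) : nat := nth 0 (rev (up_steps D)) i.
Definition arc_end (D : seq bool) (i : nat) : nat := match_step D (arc_start D i).

Variables (n : nat) (D : seq bool).
Hypothesis DyckD : Dyck n D.

Let pi := Phi_inv n D.

Let sizeD : size D = n.*2. Proof. by case: DyckD. Qed.

Local Notation start := (arc_start D).
Local Notation finish := (arc_end D).

Section OneArc.

Variable i : 'I_n.

Lemma arc_start_lt : start i < n.*2.
Proof. by rewrite -sizeD; have [] := nth_up DyckD (ltn_ord i). Qed.

Lemma arc_start_up : nth false D (start i).
Proof. by have [] := nth_up DyckD (ltn_ord i). Qed.

Lemma ups_arc_start : ups D (start i) + i.+1 = n.
Proof.
have [size_ups _] := size_stepsE DyckD; have lti := ltn_ord i.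
rewrite -(@index_filter_nth _ false) ?sizeD ?arc_start_lt ?arc_start_up //.
rewrite /arc_start nth_rev ?size_ups // -sizeD -/(up_steps D) index_uniq ?size_ups.
- by lia.
- by lia.
- by rewrite filter_uniq ?iota_uniq.
Qed.

Lemma arc_endP : [/\ start i < finish i, finish i < n.*2, ~~ nth false D (finish i),
  height D (finish i).+1 = height D (start i)
  & forall r, start i < r <= finish i -> (height D (start i) < height D r)%R].
Proof.
have [start_lt start_up] := nth_up DyckD (ltn_ord i).
by rewrite -sizeD; have := match_stepP DyckD start_lt start_up.
Qed.

Lemma downs_arc_end : downs D (finish i) = pi i.
Proof.
have [_ end_lt end_down _ _] := arc_endP; rewrite -sizeD in end_lt.
by rewrite (Phi_invE DyckD) -(@index_filter_nth _ false).
Qed.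

Lemma arc_start_lt_step u : (start i < u) = (n <= ups D u + i).
Proof.
rewrite -(@ltn_count_take _ false id D) ?sizeD ?arc_start_lt ?arc_start_up //.
by have := ups_arc_start; lia.
Qed.

Lemma arc_end_lt_step u : (finish i < u) = (pi i < downs D u).
Proof.
have [_ end_lt end_down _ _] := arc_endP.
by rewrite -(@ltn_count_take _ false negb D) ?sizeD // downs_arc_end.
Qed.

Lemma arc_center : start i + finish i + 1 + i.*2 = n.*2 + (pi i).*2.
Proof.
have [start_lt_end end_lt end_down height_end _] := arc_endP.
rewrite -sizeD in end_lt *.
have start_lt := ltn_trans start_lt_end end_lt.
have := ups_downs (ltnW start_lt); have := ups_downs end_lt.
have := count_takeS false negb end_lt; rewrite end_down downs_arc_end.
have := ups_arc_start; move: height_end; rewrite /height; lia.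
Qed.

Lemma excedance_arc : excedance pi i = (n.*2 <= start i + finish i).
Proof. by have := arc_center; rewrite /excedance; lia. Qed.

Lemma nonexcedance_arc : nonexcedance pi i = (start i + finish i < n.*2).
Proof. by have := arc_center; rewrite /nonexcedance; lia. Qed.

Lemma fixed_arc : (pi i == i) = (start i + finish i + 1 == n.*2).
Proof. by rewrite -(inj_eq val_inj) /=; have := arc_center; lia. Qed.

End OneArc.

Lemma ltn_arc_start (i j : 'I_n) : (start i < start j) = (j < i).
Proof. by rewrite arc_start_lt_step; have := ups_arc_start j; lia. Qed.

Lemma ltn_arc_end (i j : 'I_n) : (finish i < finish j) = (pi i < pi j).
Proof. by rewrite arc_end_lt_step downs_arc_end. Qed.

Lemma arc_start_inj (i j : 'I_n) : start i = start j -> i = j.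
Proof.
move=> eq_start; have := ltn_arc_start i j; have := ltn_arc_start j i.
by rewrite eq_start ltnn => ? ?; apply: val_inj => /=; lia.
Qed.

Lemma arc_end_inj (i j : 'I_n) : finish i = finish j -> i = j.
Proof.
move=> eq_end; have := ltn_arc_end i j; have := ltn_arc_end j i.
by rewrite eq_end ltnn => ? ?; apply: (@val_perm_inj _ pi); lia.
Qed.

Lemma arc_start_onto u : u < n.*2 -> nth false D u -> exists i : 'I_n, start i = u.
Proof.
move=> ltu up; have [count_ups _] := count_up DyckD.
have ltn_ups l : (ups D u < ups D l) = (u < l).
  by rewrite (@ltn_count_take _ false) ?sizeD.
have ups_lt : ups D u < n.
  by rewrite -[X in _ < X]count_ups -{2}(take_size D) ltn_ups sizeD.
have lti : n - (ups D u).+1 < n by lia.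
exists (Ordinal lti); have := arc_start_lt_step (Ordinal lti) u.
by have := ups_arc_start (Ordinal lti); have := ltn_ups (start (Ordinal lti)) => /=; lia.
Qed.

Lemma arc_end_onto u : u < n.*2 -> ~~ nth false D u -> exists i : 'I_n, finish i = u.
Proof.
move=> ltu down; have [_ count_downs] := count_up DyckD.
have ltn_downs l : (downs D u < downs D l) = (u < l).
  by rewrite (@ltn_count_take _ false) ?sizeD.
have lti : downs D u < n.
  by rewrite -[X in _ < X]count_downs -{2}(take_size D) ltn_downs sizeD.
exists ((pi^-1)%g (Ordinal lti)); have := arc_end_lt_step ((pi^-1)%g (Ordinal lti)) u.
have := ltn_downs (finish ((pi^-1)%g (Ordinal lti))).
by rewrite downs_arc_end permKV /=; lia.
Qed.

Lemma sum_arc_start_ge u : \sum_(i < n) (u <= start i) = n - ups D u.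
Proof.
rewrite -(@sum_ord_lt n (n - ups D u)) ?leq_subr //; apply: eq_bigr => i _.
by have := arc_start_lt_step i u; lia.
Qed.

Lemma sum_arc_end_lt u : \sum_(i < n) (finish i < u) = downs D u.
Proof.
have [_ count_downs] := count_up DyckD.
have downs_le : downs D u <= n.
  by rewrite -[X in _ <= X]count_downs; apply/leq_count_subseq/take_subseq.
by rewrite -(sum_perm_lt pi downs_le); apply: eq_bigr => i _; rewrite arc_end_lt_step.
Qed.

(* Two overlapping arcs are nested, and then start and end in opposite orders. *)
Lemma inversion_arcs (i j : 'I_n) : inversion pi i j = (finish j < start i).
Proof.
rewrite /inversion -ltn_arc_start -ltn_arc_end.
have [start_lt_i _ _ _ above_i] := arc_endP i.
have [start_lt_j _ _ height_j above_j] := arc_endP j.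
apply/andP/idP => [[starts ends]|disjoint]; last by lia.
rewrite ltnNge; apply/negP => overlap.
have := above_j (start i); have := above_i (finish j).+1.
by rewrite starts overlap height_j => /(_ _); lia.
Qed.

(* Let the arc of j end before the arc of i starts. If the latter starts in the
   left half, then j is a non-excedance and the type of i decides; if the former
   ends in the right half, then i is an excedance and the type of j decides;
   otherwise i is an excedance and j is not. *)
Lemma signed_inversions_arcs :
  inversions pi (excedance pi) (nonexcedance pi) +
    \sum_(i < n | (start i < n) && nonexcedance pi i) downs D (start i) +
    \sum_(j < n | (n <= finish j) && excedance pi j) (n - ups D (finish j).+1) =
  inversions pi (excedance pi) (excedance pi) +
    inversions pi (nonexcedance pi) (nonexcedance pi) +
    \sum_(i < n) \sum_(j < n) (finish j < n <= start i) +
    \sum_(i < n | (start i < n) && excedance pi i) downs D (start i) +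
    \sum_(j < n | (n <= finish j) && nonexcedance pi j) (n - ups D (finish j).+1).
Proof.
have left_pairs (P : pred 'I_n) :
    \sum_(i < n | (start i < n) && P i) downs D (start i) =
    \sum_(i < n) \sum_(j < n) [&& start i < n, P i & finish j < start i].
  under eq_bigr do rewrite -sum_arc_end_lt; rewrite sum_cond_sum.
  by apply: eq_bigr => i _; apply: eq_bigr => j _; rewrite andbA.
have right_pairs (P : pred 'I_n) :
    \sum_(j < n | (n <= finish j) && P j) (n - ups D (finish j).+1) =
    \sum_(i < n) \sum_(j < n) [&& n <= finish j, P j & finish j < start i].
  under eq_bigr do rewrite -sum_arc_start_ge; rewrite sum_cond_sum exchange_big.
  by apply: eq_bigr => i _; apply: eq_bigr => j _; rewrite andbA.
rewrite !left_pairs !right_pairs -!big_split; apply: eq_bigr => i _.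
rewrite -!big_split; apply: eq_bigr => j _ /=.
rewrite inversion_arcs !excedance_arc !nonexcedance_arc.
by have [? ? _ _ _] := arc_endP i; have [? ? _ _ _] := arc_endP j; lia.
Qed.

End Arcs.

(** * Matchings of bumped and bumping letters *)

(* The letter in position [bumper k] bumps the one in position [bumpee k]. *)
Record bump_matching n (s : 'S_n) (K : finType) (bumpee bumper : K -> 'I_n) : Prop :=
  BumpMatching {
    bumpee_inj : injective bumpee;
    bumper_inj : injective bumper;
    matched_inversion : forall k, inversion s (bumpee k) (bumper k);
    inversion_matched : forall i j, inversion s i j ->
      (i \in codom bumpee) || (j \in codom bumper);
    bumper_earliest : forall k j, inversion s (bumpee k) j -> j \notin codom bumper ->
      bumper k < j;
    bumpee_smallest : forall k i, inversion s i (bumper k) -> i \notin codom bumpee ->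
      s (bumpee k) < s i
  }.

Section UnbumpedEntry.

Variables (n : nat) (s : 'S_n) (K : finType) (bumpee bumper : K -> 'I_n).
Hypotheses (s_avoids : perm_avoids321 s) (M : bump_matching s bumpee bumper).

Variables (i : 'I_n) (k : K).
Hypotheses (not_bumped : i \notin codom bumpee) (weak_exc : i <= s i).

Let bumper_neq : bumper k != i :> nat.
Proof.
apply/eqP => /val_inj bumper_i; have := inversion_lt s_avoids (matched_inversion M k).
by rewrite bumper_i ltnNge weak_exc.
Qed.

Let bumpee_not_inverted : ~~ inversion s (bumpee k) i.
Proof. by apply/negP => /(inversion_lt s_avoids); rewrite ltnNge weak_exc. Qed.

Lemma bumpee_value_lt : (s (bumpee k) < s i) = (s (bumper k) < s i).
Proof.
have /andP[lt_k inv_k] := matched_inversion M k.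
apply/idP/idP => [|bumper_lt]; first exact: ltn_trans.
case: (ltnP (bumper k) i) => [before_i|after_i]; last first.
  by apply: (bumpee_smallest M) not_bumped; rewrite /inversion bumper_lt; lia.
have := bumpee_not_inverted; rewrite /inversion (ltn_trans lt_k before_i) /= -leqNgt.
suff /val_perm_neq : bumpee k != i :> nat by rewrite ltn_neqAle => -> ->.
by apply: contraNneq not_bumped => /val_inj <-; apply: codom_f.
Qed.

Lemma bumpee_value_ltE :
  (s (bumpee k) < s i) = (bumper k < i) + inversion s i (bumper k) :> nat.
Proof.
have /andP[lt_k inv_k] := matched_inversion M k; have := val_perm_neq s bumper_neq.
rewrite bumpee_value_lt; have := bumper_neq; have := bumpee_not_inverted.
by rewrite /inversion; lia.
Qed.

End UnbumpedEntry.

Lemma codom_comp_perm (T : finType) n (s : 'S_n) (g : T -> 'I_n) (i : 'I_n) :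
  (s i \in codom (s \o g)) = (i \in codom g).
Proof. by rewrite !codomE map_comp mem_map //; apply: perm_inj. Qed.

(* Inverting a permutation exchanges the two tableaux of RSK. *)
Lemma bump_matching_inv n (s : 'S_n) (K : finType) (bumpee bumper : K -> 'I_n) :
  bump_matching s bumpee bumper -> bump_matching s^-1%g (s \o bumper) (s \o bumpee).
Proof.
move=> M; split.
- exact: inj_comp perm_inj (bumper_inj M).
- exact: inj_comp perm_inj (bumpee_inj M).
- by move=> k; rewrite inversion_inv; apply: matched_inversion M k.
- move=> x y; rewrite -[x](permKV s) -[y](permKV s) inversion_inv !codom_comp_perm orbC.
  exact: inversion_matched M _ _.
- move=> k y; rewrite -[y](permKV s) inversion_inv codom_comp_perm.
  exact: (bumpee_smallest M).
- move=> k x; rewrite -[x](permKV s) inversion_inv codom_comp_perm !permK.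
  exact: (bumper_earliest M).
Qed.

Section UnbumpingEntry.

Variables (n : nat) (s : 'S_n) (K : finType) (bumpee bumper : K -> 'I_n).
Hypotheses (s_avoids : perm_avoids321 s) (M : bump_matching s bumpee bumper).

Variables (j : 'I_n) (k : K).
Hypotheses (not_bumping : j \notin codom bumper) (nonexc : s j <= j).

Let not_bumping_inv : s j \notin codom (s \o bumper).
Proof. by rewrite codom_comp_perm. Qed.

Let weak_exc_inv : s j <= s^-1%g (s j).
Proof. by rewrite permK. Qed.

Lemma bumper_position_lt : (bumper k < j) = (bumpee k < j).
Proof.
have := bumpee_value_lt (perm_avoids321_inv s_avoids) (bump_matching_inv M) k
  not_bumping_inv weak_exc_inv.
by rewrite /= !permK.
Qed.

Lemma bumper_position_ltE :
  (bumper k < j) = (s (bumpee k) < s j) + inversion s (bumpee k) j :> nat.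
Proof.
have := bumpee_value_ltE (perm_avoids321_inv s_avoids) (bump_matching_inv M) k
  not_bumping_inv weak_exc_inv.
by rewrite /= inversion_inv !permK.
Qed.

End UnbumpingEntry.

Section Matching.

Variables (n : nat) (s : 'S_n) (K : finType) (bumpee bumper : K -> 'I_n).
Hypotheses (s_avoids : perm_avoids321 s) (M : bump_matching s bumpee bumper).

Local Notation bumped i := (i \in codom bumpee).
Local Notation bumping i := (i \in codom bumper).

Definition bumped_below v := \sum_k (s (bumpee k) < v).
Definition bumpers_before t := \sum_k (bumper k < t).

Lemma bumped_excedance (i : 'I_n) : bumped i -> excedance s i.
Proof.
by case/codomP => k ->; apply: inversion_excedance s_avoids (matched_inversion M k).
Qed.

Lemma bumping_lt (i : 'I_n) : bumping i -> s i < i.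
Proof. by case/codomP => k ->; apply: (inversion_lt s_avoids) (matched_inversion M k). Qed.

Lemma excedance_not_bumping (i : 'I_n) : excedance s i -> ~~ bumping i.
Proof. by rewrite /excedance => exc_i; apply/negP => /bumping_lt; lia. Qed.

Lemma nonexcedance_not_bumped (i : 'I_n) : nonexcedance s i -> ~~ bumped i.
Proof.
by rewrite /nonexcedance => non_i; apply/negP => /bumped_excedance; rewrite /excedance; lia.
Qed.

Lemma matched_pair_trichotomy k l :
  1 = (bumper l < bumpee k) + (s (bumpee k) < s (bumper l)) +
      inversion s (bumpee k) (bumper l).
Proof.
have := bumped_excedance (codom_f bumpee k); have := bumping_lt (codom_f bumper l).
have : bumpee k != bumper l :> nat.
  apply: contraTneq (codom_f bumpee k) => /val_inj ->.
  by apply/nonexcedance_not_bumped/ltnW/bumping_lt/codom_f.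
rewrite /excedance /inversion => neq; have := @val_perm_neq n s _ _ neq; lia.
Qed.

Lemma sum_inversions_matching : \sum_i \sum_j inversion s i j =
  \sum_k \sum_l inversion s (bumpee k) (bumper l) +
  \sum_(j | nonexcedance s j && ~~ bumping j) \sum_k inversion s (bumpee k) j +
  \sum_(i | excedance s i && ~~ bumped i) \sum_k inversion s i (bumper k).
Proof.
rewrite (sum_notin_codom _ (bumpee_inj M)); congr (_ + _).
  under eq_bigr do rewrite (sum_notin_codom _ (bumper_inj M)).
  rewrite big_split /= [X in _ + X = _]exchange_big; congr (_ + _).
  rewrite [LHS](bigID (nonexcedance s)) /= [X in _ + X]big1 => [|j /andP[_ exc_j]].
    by rewrite addn0; apply: eq_bigl => j; rewrite andbC.
  apply: big1 => k _; case: (boolP (inversion _ _ _)) => //.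
  by move/(inversion_nonexcedance s_avoids); rewrite (negbTE exc_j).
rewrite [LHS](bigID (excedance s)) /= [X in _ + X]big1 => [|i /andP[_ non_i]].
  rewrite addn0; apply: eq_big => [i|i /andP[not_bumped _]]; first by rewrite andbC.
  rewrite (sum_notin_codom _ (bumper_inj M)) [X in _ + X]big1 ?addn0 // => j not_bumping.
  case: (boolP (inversion _ _ _)) => // /(inversion_matched M).
  by rewrite (negbTE not_bumped) (negbTE not_bumping).
apply: big1 => j _; case: (boolP (inversion _ _ _)) => // /(inversion_excedance s_avoids).
by rewrite (negbTE non_i).
Qed.

Lemma sum_nonexcedance_codom (F : 'I_n -> nat) : \sum_(j | nonexcedance s j) F j =
  \sum_k F (bumper k) + \sum_(j | nonexcedance s j && ~~ bumping j) F j.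
Proof.
rewrite (bigID [in codom bumper]) -(sum_codom _ (bumper_inj M)); congr (_ + _).
apply: eq_bigl => j; apply: andb_idl => /bumping_lt; exact: ltnW.
Qed.

Lemma sum_excedance_codom (F : 'I_n -> nat) : \sum_(i | excedance s i) F i =
  \sum_k F (bumpee k) + \sum_(i | excedance s i && ~~ bumped i) F i.
Proof.
rewrite (bigID [in codom bumpee]) -(sum_codom _ (bumpee_inj M)); congr (_ + _).
apply: eq_bigl => i; apply: andb_idl; exact: bumped_excedance.
Qed.

(* An inversion joins a bumpee and a bumper, a bumpee and an unmatched entry, or
   an unmatched entry and a bumper; the pairs of each kind are counted by a
   difference of terms of the two sides. *)
Lemma crs_exc_matching : crs s + exc s +
    \sum_(j | nonexcedance s j) bumped_below (s j) +
    \sum_(i | excedance s i) bumpers_before i =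
  #|K| * #|K| +
    \sum_(i | excedance s i && ~~ bumped i) bumped_below (s i) +
    \sum_(j | nonexcedance s j && ~~ bumping j) bumpers_before j.
Proof.
have -> : #|K| * #|K| = \sum_k bumpers_before (bumpee k) +
    \sum_k bumped_below (s (bumper k)) +
    \sum_k \sum_l inversion s (bumpee k) (bumper l).
  rewrite [X in _ + X + _]exchange_big -!big_split -sum_nat_const.
  rewrite (eq_bigl xpredT) //; apply: eq_bigr => k _.
  by rewrite -!big_split -sum1_card; apply: eq_bigr => l _; apply: matched_pair_trichotomy.
have -> : \sum_(i | excedance s i && ~~ bumped i) bumped_below (s i) =
    \sum_(i | excedance s i && ~~ bumped i) bumpers_before i +
    \sum_(i | excedance s i && ~~ bumped i) \sum_k inversion s i (bumper k).
  rewrite -big_split; apply: eq_bigr => i /andP[exc_i not_bumped].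
  by rewrite -big_split; apply: eq_bigr => k _; apply: bumpee_value_ltE; rewrite // ltnW.
have -> : \sum_(j | nonexcedance s j && ~~ bumping j) bumpers_before j =
    \sum_(j | nonexcedance s j && ~~ bumping j) bumped_below (s j) +
    \sum_(j | nonexcedance s j && ~~ bumping j) \sum_k inversion s (bumpee k) j.
  rewrite -big_split; apply: eq_bigr => j /andP[non_j not_bumping].
  by rewrite -big_split; apply: eq_bigr => k _; apply: bumper_position_ltE.
rewrite (crs_exc_avoids321 s_avoids) sum_inversions_matching.
by rewrite sum_nonexcedance_codom sum_excedance_codom; lia.
Qed.

Definition unmatched (i : 'I_n) := ~~ bumped i && ~~ bumping i.

Definition unmatched_below v := \sum_(i | unmatched i) (s i < v).
Definition unmatched_before t := \sum_(i | unmatched i) (i < t).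

Lemma sum_matching (F : 'I_n -> nat) :
  \sum_i F i = \sum_k F (bumpee k) + \sum_k F (bumper k) + \sum_(i | unmatched i) F i.
Proof.
rewrite (sum_notin_codom _ (bumpee_inj M)) -addnA; congr (_ + _).
rewrite (bigID [in codom bumper]) -(sum_codom _ (bumper_inj M)); congr (_ + _).
by apply: eq_bigl => i; apply: andb_idl => /bumping_lt/ltnW/nonexcedance_not_bumped.
Qed.

Lemma unmatched_weak_excedance (i : 'I_n) : ~~ bumped i -> i <= s i -> unmatched i.
Proof.
move=> not_bumped weak_exc; rewrite /unmatched not_bumped /=.
by apply/negP => /bumping_lt; rewrite ltnNge weak_exc.
Qed.

Lemma unmatched_nonexcedance (j : 'I_n) : ~~ bumping j -> nonexcedance s j -> unmatched j.
Proof. by move=> not_bumping /nonexcedance_not_bumped not_bumped; apply/andP. Qed.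

Lemma unmatched_mono i j : unmatched i -> unmatched j -> (s i < s j) = (i < j).
Proof.
have no_inversion x y : unmatched x -> unmatched y -> ~~ inversion s x y.
  move=> /andP[not_bumped _] /andP[_ not_bumping]; apply/negP => /(inversion_matched M).
  by rewrite (negbTE not_bumped) (negbTE not_bumping).
move=> unmatched_i unmatched_j.
have := no_inversion i j unmatched_i unmatched_j.
have := no_inversion j i unmatched_j unmatched_i.
rewrite /inversion; case: (ltngtP i j) => [ij|ij|/val_inj->]; rewrite ?ltnn //.
  by have := @val_perm_neq n s i j; lia.
by lia.
Qed.

Lemma unmatched_before_lt i t : unmatched i -> i < t ->
  unmatched_before i < unmatched_before t.
Proof.
move=> unmatched_i it; rewrite /unmatched_before (bigD1 i) //= [X in _ < X](bigD1 i) //=.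
by rewrite ltnn it ltnS; apply: leq_sum => j _; lia.
Qed.

Lemma unmatched_before_lt_below i v : unmatched i -> s i < v ->
  unmatched_before i < unmatched_below v.
Proof.
move=> unmatched_i iv; rewrite /unmatched_before (bigD1 i) //= [X in _ < X](bigD1 i) //=.
rewrite ltnn iv ltnS; apply: leq_sum => j /andP[unmatched_j _].
by rewrite -unmatched_mono //; lia.
Qed.

Lemma unmatched_belowE i : unmatched i -> unmatched_below (s i) = unmatched_before i.
Proof. by move=> unmatched_i; apply: eq_bigr => j unmatched_j; rewrite unmatched_mono. Qed.

Lemma bumped_below_all : bumped_below n = #|K|.
Proof. by rewrite -sum1_card; apply: eq_bigr => k _; rewrite ltn_ord. Qed.

Lemma bumpers_before_all : bumpers_before n = #|K|.
Proof. by rewrite -sum1_card; apply: eq_bigr => k _; rewrite ltn_ord. Qed.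

Lemma value_decomposition v : v <= n ->
  bumped_below v + \sum_k (s (bumper k) < v) + unmatched_below v = v.
Proof.
by move=> vn; rewrite -[RHS](sum_perm_lt s vn) (sum_matching (fun i => (s i < v) : nat)).
Qed.

Lemma position_decomposition t : t <= n ->
  \sum_k (bumpee k < t) + bumpers_before t + unmatched_before t = t.
Proof.
by move=> tn; rewrite -[RHS](sum_ord_lt tn) (sum_matching (fun i => (i < t) : nat)).
Qed.

Lemma unmatched_below_le v : v <= n -> (bumped_below v).*2 + unmatched_below v <= v.
Proof.
move=> vn; rewrite -[X in _ <= X](value_decomposition vn) leq_add2r -addnn leq_add2l.
by apply: leq_sum => k _; have /andP[_] := matched_inversion M k; lia.
Qed.

Lemma unmatched_before_le t : t <= n -> (bumpers_before t).*2 + unmatched_before t <= t.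
Proof.
move=> tn; rewrite -[X in _ <= X](position_decomposition tn) leq_add2r -addnn leq_add2r.
by apply: leq_sum => k _; have /andP[] := matched_inversion M k; lia.
Qed.

Lemma unmatched_value (i : 'I_n) : ~~ bumped i -> i <= s i ->
  (bumped_below (s i)).*2 + unmatched_before i = s i.
Proof.
move=> not_bumped weak_exc; rewrite -[RHS](value_decomposition (ltnW (ltn_ord (s i)))).
rewrite unmatched_belowE ?unmatched_weak_excedance // -addnn; congr (_ + _ + _).
by apply: eq_bigr => k _; rewrite (bumpee_value_lt s_avoids M).
Qed.

Lemma unmatched_position (j : 'I_n) : ~~ bumping j -> s j <= j ->
  (bumpers_before j).*2 + unmatched_before j = j.
Proof.
move=> not_bumping nonexc; rewrite -[RHS](position_decomposition (ltnW (ltn_ord j))).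
rewrite -addnn; congr (_ + _ + _).
by apply: eq_bigr => k _; rewrite (bumper_position_lt s_avoids M).
Qed.

(* D is read from the left along the values of s and from the right along its
   positions. *)
Definition matching_path (D : seq bool) :=
  [/\ size D = n.*2,
      forall i, nth false D (s i) = ~~ bumped i
    & forall j : 'I_n, nth false (rev D) j = bumping j].

Section Path.

Variable D : seq bool.
Hypothesis path_D : matching_path D.

Let sizeD : size D = n.*2. Proof. by case: path_D. Qed.
Let D_left i : nth false D (s i) = ~~ bumped i. Proof. by case: path_D. Qed.
Let D_right (j : 'I_n) : nth false (rev D) j = bumping j. Proof. by case: path_D. Qed.

Lemma downs_left k : k <= n -> count negb (take k D) = bumped_below k.
Proof.
move=> kn; rewrite (count_take_sum false) ?sizeD; last by lia.
rewrite (big_ord_widen n (fun u => ~~ nth false D u : nat) kn) big_mkcond.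
rewrite -(sum_perm s) /bumped_below -(sum_codom (fun i => (s i < k) : nat) (bumpee_inj M)).
rewrite [RHS]big_mkcond; apply: eq_bigr => i _.
by rewrite D_left negbK; case: (bumped i); case: (s i < k).
Qed.

Lemma ups_right k : k <= n -> count id (take k (rev D)) = bumpers_before k.
Proof.
move=> kn; rewrite (count_take_sum false) ?size_rev ?sizeD; last by lia.
rewrite (big_ord_widen n (fun u => nth false (rev D) u : nat) kn) big_mkcond.
rewrite /bumpers_before -(sum_codom (fun j : 'I_n => (j < k) : nat) (bumper_inj M)).
rewrite [RHS]big_mkcond; apply: eq_bigr => j _.
by rewrite D_right; case: (bumping j); case: (j < k).
Qed.

Lemma ups_matching_path : count id D = n.
Proof.
have nn : n.*2 - n = n by lia.
rewrite -(@count_take_rev _ id D n) sizeD 1?nn ?ups_right //; last by lia.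
rewrite bumpers_before_all -bumped_below_all -downs_left // ups_downs // sizeD; lia.
Qed.

Lemma ups_right_complement k : k <= n ->
  count id (take (n.*2 - k) D) + bumpers_before k = n.
Proof.
by move=> kn; rewrite -ups_right // -sizeD count_take_rev ?ups_matching_path // sizeD; lia.
Qed.

Lemma height_left k : k <= n -> height D k = (k%:Z - (bumped_below k).*2%:Z)%R.
Proof.
move=> kn; have := @ups_downs D k; rewrite /height downs_left // sizeD; lia.
Qed.

Lemma height_right k : k <= n -> height D (n.*2 - k) = (k%:Z - (bumpers_before k).*2%:Z)%R.
Proof.
move=> kn; have := ups_right_complement kn; have := @ups_downs D (n.*2 - k).
by rewrite /height sizeD; lia.
Qed.

Lemma unmatched_below_le_height v : v <= n -> ((unmatched_below v)%:Z <= height D v)%R.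
Proof. by move=> vn; have := unmatched_below_le vn; rewrite height_left //; lia. Qed.

Lemma unmatched_before_le_height t : t <= n ->
  ((unmatched_before t)%:Z <= height D (n.*2 - t))%R.
Proof. by move=> tn; have := unmatched_before_le tn; rewrite height_right //; lia. Qed.

Lemma matching_path_Dyck : Dyck n D.
Proof.
have height_end : height D n.*2 = 0%R.
  by have := height_right (leq0n n); rewrite subn0 /bumpers_before big1 // => k _.
split=> // k; case: (leqP k n) => [kn|nk].
  by have := unmatched_below_le_height kn; lia.
case: (leqP k n.*2) => [k2n|k2n].
  have tn : n.*2 - k <= n by lia.
  by have := unmatched_before_le_height tn; rewrite subKn //; lia.
suff -> : height D k = height D n.*2 by rewrite height_end.
by rewrite /height !take_oversize ?sizeD // ltnW.
Qed.

Lemma height_value (i : 'I_n) : ~~ bumped i -> i <= s i ->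
  height D (s i) = (unmatched_before i)%:Z%R.
Proof.
move=> not_bumped weak_exc; have := unmatched_value not_bumped weak_exc.
by rewrite height_left 1?ltnW //; lia.
Qed.

Lemma height_position (j : 'I_n) : ~~ bumping j -> s j <= j ->
  height D (n.*2 - j) = (unmatched_before j)%:Z%R.
Proof.
move=> not_bumping nonexc; have := unmatched_position not_bumping nonexc.
by rewrite height_right 1?ltnW //; lia.
Qed.

Lemma height_gt_left i v : unmatched i -> s i < v <= n ->
  ((unmatched_before i)%:Z < height D v)%R.
Proof.
move=> unmatched_i /andP[iv vn]; have := unmatched_below_le_height vn.
by have := unmatched_before_lt_below unmatched_i iv; lia.
Qed.

Lemma height_gt_right i t : unmatched i -> i < t <= n ->
  ((unmatched_before i)%:Z < height D (n.*2 - t))%R.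
Proof.
move=> unmatched_i /andP[it tn]; have := unmatched_before_le_height tn.
by have := unmatched_before_lt unmatched_i it; lia.
Qed.

Let pi := Phi_inv n D.
Let DyckD := matching_path_Dyck.

Local Notation start := (arc_start D).
Local Notation finish := (arc_end D).

(* The default values are only used for bumped, respectively bumping, entries. *)
Definition arc_from (i : 'I_n) : 'I_n :=
  odflt i [pick a : 'I_n | start a == s i].

Definition arc_to (j : 'I_n) : 'I_n :=
  odflt j [pick a : 'I_n | finish a == n.*2.-1 - j].

Lemma arc_start_from (i : 'I_n) : ~~ bumped i -> start (arc_from i) = s i.
Proof.
move=> not_bumped; rewrite /arc_from; case: pickP => [a /eqP //|no_arc].
have [||a start_a] := @arc_start_onto n D DyckD (s i); rewrite ?D_left //.
  by have := ltn_ord (s i); lia.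
by have := no_arc a; rewrite start_a eqxx.
Qed.

Lemma arc_end_to (j : 'I_n) : ~~ bumping j -> finish (arc_to j) = n.*2.-1 - j.
Proof.
move=> not_bumping; rewrite /arc_to; case: pickP => [a /eqP //|no_arc].
have lt_j := ltn_ord j; have lt_j2 : j < n.*2 by lia.
have [||a end_a] := @arc_end_onto n D DyckD (n.*2.-1 - j); first by lia.
  move: not_bumping; rewrite -D_right nth_rev sizeD //.
  by congr (~~ nth _ _ _); lia.
by have := no_arc a; rewrite end_a eqxx.
Qed.

Lemma sum_left_starts (F : 'I_n -> nat) :
  \sum_(a < n | start a < n) F a = \sum_(i | ~~ bumped i) F (arc_from i).
Proof.
transitivity (\sum_(a in arc_from @: [set i | ~~ bumped i]) F a).
  apply: eq_bigl => a; apply/idP/imsetP => [lt_a|[i]]; last first.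
    by rewrite inE => /arc_start_from start_i ->; rewrite start_i.
  have start_a : start a = s ((s^-1)%g (Ordinal lt_a)) by rewrite permKV.
  have not_bumped : ~~ bumped ((s^-1)%g (Ordinal lt_a)).
    by rewrite -D_left -start_a (arc_start_up DyckD).
  exists ((s^-1)%g (Ordinal lt_a)); first by rewrite inE.
  by apply: (arc_start_inj DyckD); rewrite arc_start_from.
rewrite big_imset => [|i j]; first by apply: eq_bigl => i; rewrite inE.
rewrite !inE => /arc_start_from start_i /arc_start_from start_j eq_arc.
by apply: (@val_perm_inj _ s); rewrite -start_i eq_arc.
Qed.

Lemma sum_right_ends (F : 'I_n -> nat) :
  \sum_(a < n | n <= finish a) F a = \sum_(j | ~~ bumping j) F (arc_to j).
Proof.
transitivity (\sum_(a in arc_to @: [set j | ~~ bumping j]) F a).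
  apply: eq_bigl => a; apply/idP/imsetP => [ge_n|[j]]; last first.
    by rewrite inE => /arc_end_to end_j ->; rewrite end_j; have := ltn_ord j; lia.
  have [_ lt_end end_down _ _] := arc_endP DyckD a.
  have lt_j : n.*2.-1 - finish a < n by lia.
  have end_a : finish a = n.*2.-1 - Ordinal lt_j by rewrite /=; lia.
  have not_bumping : ~~ bumping (Ordinal lt_j).
    rewrite -D_right nth_rev sizeD /=; last by lia.
    by rewrite (_ : _ - _ = finish a) //; lia.
  exists (Ordinal lt_j); first by rewrite inE.
  by apply: (arc_end_inj DyckD); rewrite arc_end_to.
rewrite big_imset => [|i j]; first by apply: eq_bigl => j; rewrite inE.
rewrite !inE => /arc_end_to end_i /arc_end_to end_j eq_arc; apply: val_inj => /=.
have := end_i; rewrite eq_arc end_j; have := ltn_ord i; have := ltn_ord j; lia.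
Qed.

Lemma sum_right_starts : \sum_(a < n) (n <= start a) = #|K|.
Proof.
rewrite (sum_arc_start_ge DyckD) -bumpers_before_all.
by have := ups_right_complement (leqnn n); rewrite (_ : n.*2 - n = n); lia.
Qed.

Lemma sum_left_ends : \sum_(a < n) (finish a < n) = #|K|.
Proof. by rewrite (sum_arc_end_lt DyckD) downs_left // bumped_below_all. Qed.

Lemma excedance_arc_from_excedance (i : 'I_n) : ~~ bumped i -> excedance s i ->
  excedance pi (arc_from i).
Proof.
move=> not_bumped exc_i; have start_i := arc_start_from not_bumped.
have unmatched_i := unmatched_weak_excedance not_bumped (ltnW exc_i).
have [start_lt end_lt _ height_end _] := arc_endP DyckD (arc_from i).
rewrite (excedance_arc DyckD) leqNgt; apply/negP => left_of_middle.
move: height_end; rewrite start_i height_value ?(ltnW exc_i) // => height_end.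
have : ((unmatched_before i)%:Z < height D (finish (arc_from i)).+1)%R.
  case: (leqP (finish (arc_from i)).+1 n) => [left_half|right_half].
    by apply: height_gt_left unmatched_i _; lia.
  have -> : (finish (arc_from i)).+1 = n.*2 - (n.*2 - (finish (arc_from i)).+1) by lia.
  by apply: height_gt_right unmatched_i _; move: exc_i; rewrite /excedance; lia.
by rewrite height_end ltxx.
Qed.

Lemma height_start_to (j : 'I_n) : ~~ bumping j -> nonexcedance s j ->
  height D (start (arc_to j)) = (unmatched_before j)%:Z%R.
Proof.
move=> not_bumping non_j; have [_ _ _ <- _] := arc_endP DyckD (arc_to j).
rewrite arc_end_to // -(height_position not_bumping non_j); congr height.
by have := ltn_ord j; lia.
Qed.

Lemma start_to_le (j : 'I_n) : ~~ bumping j -> nonexcedance s j -> start (arc_to j) <= j.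
Proof.
move=> not_bumping non_j; have end_j := arc_end_to not_bumping; have lt_j := ltn_ord j.
have unmatched_j := unmatched_nonexcedance not_bumping non_j.
have [start_lt end_lt _ _ _] := arc_endP DyckD (arc_to j).
rewrite leqNgt; apply/negP => gt_j.
suff : ((unmatched_before j)%:Z < height D (start (arc_to j)))%R.
  by rewrite height_start_to // ltxx.
case: (leqP (start (arc_to j)) n) => [left_half|right_half].
  by apply: height_gt_left unmatched_j _; move: non_j; rewrite /nonexcedance; lia.
have -> : start (arc_to j) = n.*2 - (n.*2 - start (arc_to j)) by lia.
by apply: height_gt_right unmatched_j _; lia.
Qed.

Lemma start_to_eq (j : 'I_n) : ~~ bumping j -> nonexcedance s j ->
  (start (arc_to j) == j) = (s j == j).
Proof.
move=> not_bumping non_j; have height_start := height_start_to not_bumping non_j.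
apply/eqP/eqP => [start_j|fixed_j].
  apply/val_inj/eqP; rewrite /= eqn_leq -/(nonexcedance s j) non_j leqNgt.
  have unmatched_j := unmatched_nonexcedance not_bumping non_j.
  apply/negP => sj; have := @height_gt_left j j unmatched_j; rewrite sj ltnW // => /(_ isT).
  by rewrite -{2}start_j height_start ltxx.
have := start_to_le not_bumping non_j; rewrite leq_eqVlt => /predU1P[//|start_lt_j].
have height_j : height D j = (unmatched_before j)%:Z%R.
  by have := height_value (nonexcedance_not_bumped non_j); rewrite fixed_j; apply.
have [_ _ _ _ /(_ j)] := arc_endP DyckD (arc_to j).
rewrite height_start height_j start_lt_j ltxx arc_end_to //.
by have := ltn_ord j => lt_j /(_ _); lia.
Qed.

Lemma exc_matching : exc s = #|K| + \sum_(i | ~~ bumped i) excedance s i.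
Proof.
rewrite exc_sum (sum_notin_codom _ (bumpee_inj M)) -sum1_card; congr (_ + _).
by apply: eq_bigr => k _; rewrite bumped_excedance ?codom_f.
Qed.

Lemma nonexc_matching : n = exc s + #|K| + \sum_(j | ~~ bumping j) nonexcedance s j.
Proof.
rewrite -[LHS]card_ord -sum1_card exc_sum -addnA.
have <- : \sum_j nonexcedance s j = #|K| + \sum_(j | ~~ bumping j) nonexcedance s j.
  rewrite (sum_notin_codom _ (bumper_inj M)) -[in RHS]sum1_card; congr (_ + _).
  by apply: eq_bigr => k _; rewrite /nonexcedance ltnW ?bumping_lt ?codom_f.
by rewrite -big_split; apply: eq_bigr => i _; rewrite /excedance /nonexcedance /=; lia.
Qed.

Lemma exc_arcs : exc pi = #|K| + \sum_(i | ~~ bumped i) excedance pi (arc_from i).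
Proof.
rewrite -(sum_left_starts (fun a => excedance pi a : nat)) exc_sum -sum_right_starts.
rewrite [X in _ + X]big_mkcond -big_split.
apply: eq_bigr => a _ /=; rewrite (excedance_arc DyckD).
by have [? _ _ _ _] := arc_endP DyckD a; case: (ltnP (start a) n); lia.
Qed.

Lemma nonexc_arcs : n = exc pi + #|K| + \sum_(j | ~~ bumping j) nonexcedance pi (arc_to j).
Proof.
rewrite -(sum_right_ends (fun a => nonexcedance pi a : nat)) -[LHS]card_ord -sum1_card.
rewrite exc_sum -sum_left_ends [X in _ + X]big_mkcond -!big_split.
apply: eq_bigr => a _ /=; rewrite (excedance_arc DyckD) (nonexcedance_arc DyckD).
by have [? _ _ _ _] := arc_endP DyckD a; case: (leqP n (finish a)); lia.
Qed.

Lemma excedance_le_arc_from (i : 'I_n) : ~~ bumped i ->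
  excedance s i <= excedance pi (arc_from i).
Proof.
move=> not_bumped; case: (boolP (excedance s i)) => // /excedance_arc_from_excedance.
by move=> /(_ not_bumped) ->.
Qed.

Lemma nonexcedance_le_arc_to (j : 'I_n) : ~~ bumping j ->
  nonexcedance s j <= nonexcedance pi (arc_to j).
Proof.
move=> not_bumping; case: (boolP (nonexcedance s j)) => // non_j.
have start_le := start_to_le not_bumping non_j; have lt_j := ltn_ord j.
by rewrite (nonexcedance_arc DyckD) arc_end_to // (_ : _ < _); lia.
Qed.

Lemma exc_preserved : exc pi = exc s.
Proof.
have exc_le : \sum_(i | ~~ bumped i) excedance s i <=
    \sum_(i | ~~ bumped i) excedance pi (arc_from i).
  exact: leq_sum excedance_le_arc_from.
have nonexc_le : \sum_(j | ~~ bumping j) nonexcedance s j <=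
    \sum_(j | ~~ bumping j) nonexcedance pi (arc_to j).
  exact: leq_sum nonexcedance_le_arc_to.
have := exc_matching; have := nonexc_matching; have := exc_arcs; have := nonexc_arcs.
lia.
Qed.

Lemma excedance_arc_from (i : 'I_n) : ~~ bumped i ->
  excedance pi (arc_from i) = excedance s i.
Proof.
move=> not_bumped; have sum_le : \sum_(i | ~~ bumped i) excedance pi (arc_from i) <=
    \sum_(i | ~~ bumped i) excedance s i.
  by have := exc_matching; have := exc_arcs; rewrite exc_preserved; lia.
have := eq_of_leq_sum excedance_le_arc_from sum_le not_bumped.
by case: (excedance s i); case: (excedance pi _).
Qed.

Lemma nonexcedance_arc_to (j : 'I_n) : ~~ bumping j ->
  nonexcedance pi (arc_to j) = nonexcedance s j.
Proof.
move=> not_bumping; have sum_le : \sum_(j | ~~ bumping j) nonexcedance pi (arc_to j) <=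
    \sum_(j | ~~ bumping j) nonexcedance s j.
  by have := nonexc_matching; have := nonexc_arcs; rewrite exc_preserved; lia.
have := eq_of_leq_sum nonexcedance_le_arc_to sum_le not_bumping.
by case: (nonexcedance s j); case: (nonexcedance pi _).
Qed.

Lemma fixed_arc_to (j : 'I_n) : ~~ bumping j -> (pi (arc_to j) == arc_to j) = (s j == j).
Proof.
move=> not_bumping; have lt_j := ltn_ord j.
have [non_j|exc_j] := boolP (nonexcedance s j).
  have start_le := start_to_le not_bumping non_j; rewrite -start_to_eq //.
  by rewrite (fixed_arc DyckD) arc_end_to //; apply/eqP/eqP; lia.
have := exc_j; rewrite -nonexcedance_arc_to // => exc_arc.
by apply/eqP/eqP => eq_j; [move: exc_arc|move: exc_j]; rewrite /nonexcedance eq_j leqnn.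
Qed.

Lemma fp_preserved : fp pi = fp s.
Proof.
have -> : fp s = \sum_(j | ~~ bumping j) (s j == j).
  rewrite /fp card_set_sum (sum_notin_codom _ (bumper_inj M)) big1 // => k _.
  have := bumping_lt (codom_f bumper k).
  by case: eqP => // ->; rewrite ltnn.
transitivity (\sum_(j | ~~ bumping j) (pi (arc_to j) == arc_to j)); last first.
  by apply: eq_bigr => j not_bumping; rewrite fixed_arc_to.
rewrite -(sum_right_ends (fun a => (pi a == a) : nat)) /fp card_set_sum [RHS]big_mkcond.
apply: eq_bigr => a _; rewrite (fixed_arc DyckD); have [? _ _ _ _] := arc_endP DyckD a.
by case: (leqP n (finish a)) => //; case: eqP; lia.
Qed.

Lemma sum_downs_before_left_starts (P Q : pred 'I_n) :
  (forall i, ~~ bumped i -> P (arc_from i) = Q i) ->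
  \sum_(a < n | (start a < n) && P a) count negb (take (start a) D) =
  \sum_(i | Q i && ~~ bumped i) bumped_below (s i).
Proof.
move=> eqPQ; rewrite big_mkcondr sum_left_starts [RHS]big_mkcondl.
by apply: eq_bigr => i not_bumped; rewrite eqPQ // arc_start_from // downs_left // ltnW.
Qed.

Lemma sum_ups_after_right_ends (P Q : pred 'I_n) :
  (forall j, ~~ bumping j -> P (arc_to j) = Q j) ->
  \sum_(a < n | (n <= finish a) && P a) (n - count id (take (finish a).+1 D)) =
  \sum_(j | Q j && ~~ bumping j) bumpers_before j.
Proof.
move=> eqPQ; rewrite big_mkcondr sum_right_ends [RHS]big_mkcondl.
apply: eq_bigr => j not_bumping; have lt_j := ltn_ord j.
rewrite eqPQ // arc_end_to // (_ : _.+1 = n.*2 - j); last by lia.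
by have := ups_right_complement (ltnW lt_j); case: (Q j) => //; lia.
Qed.

Lemma sum_left_ends_right_starts :
  \sum_(a < n) \sum_(b < n) (finish b < n <= start a) = #|K| * #|K|.
Proof.
rewrite -{1}sum_right_starts big_distrl; apply: eq_bigr => a _ /=.
by rewrite -sum_left_ends big_distrr; apply: eq_bigr => b _ /=; rewrite andbC mulnb.
Qed.

Lemma crs_exc_path : crs pi + exc pi +
    \sum_(j | nonexcedance s j) bumped_below (s j) +
    \sum_(i | excedance s i) bumpers_before i =
  #|K| * #|K| +
    \sum_(i | excedance s i && ~~ bumped i) bumped_below (s i) +
    \sum_(j | nonexcedance s j && ~~ bumping j) bumpers_before j.
Proof.
have drop_bumped : \sum_(i | nonexcedance s i && ~~ bumped i) bumped_below (s i) =
    \sum_(i | nonexcedance s i) bumped_below (s i).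
  by apply: eq_bigl => i; apply: andb_idr => /nonexcedance_not_bumped.
have drop_bumping : \sum_(j | excedance s j && ~~ bumping j) bumpers_before j =
    \sum_(j | excedance s j) bumpers_before j.
  by apply: eq_bigl => j; apply: andb_idr => /excedance_not_bumping.
have nonexcedance_arc_from i : ~~ bumped i ->
    nonexcedance pi (arc_from i) = nonexcedance s i.
  by move=> not_bumped; rewrite !nonexcedanceN excedance_arc_from.
have excedance_arc_to j : ~~ bumping j -> excedance pi (arc_to j) = excedance s j.
  by move=> not_bumping; rewrite !excedanceN nonexcedance_arc_to.
have := crs_exc_inversions pi; have := signed_inversions_arcs DyckD.
rewrite (sum_downs_before_left_starts excedance_arc_from).
rewrite (sum_downs_before_left_starts nonexcedance_arc_from).
rewrite (sum_ups_after_right_ends nonexcedance_arc_to).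
rewrite (sum_ups_after_right_ends excedance_arc_to).
by rewrite sum_left_ends_right_starts drop_bumped drop_bumping -/pi; lia.
Qed.

Lemma crs_preserved : crs pi = crs s.
Proof.
by have := crs_exc_path; have := crs_exc_matching; rewrite exc_preserved; lia.
Qed.

End Path.

End Matching.

(** * The second rows of the tableaux *)

Section RowInsertion.

Local Notation row T k := (nth [::] T k).

Lemma row_insert_append x T : {in row T 0, forall y, y <= x} ->
  row_insert x T = (rcons (row T 0) x :: behead T, 0).
Proof.
case: T => [|r T] //= le_x; case: ifP => //.
by rewrite -has_find => /hasP[y /le_x] /=; lia.
Qed.

Lemma row_insert_bump x T (r := row T 0) (k := find (fun y => x < y) r) :
  k < size r ->
  row_insert x T =
    let: (T', i) := row_insert (nth 0 r k) (behead T) in (set_nth 0 r k x :: T', i.+1).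
Proof. by rewrite /k /r; case: T {r k} => //= r T ->. Qed.

Section BumpedRow.

Variables (r : seq nat) (x : nat).

Let k := find (fun y => x < y) r.
Let y := nth 0 r k.

Lemma lt_bumped : k < size r -> x < y.
Proof. by move=> bump; apply: (nth_find 0); rewrite has_find. Qed.

Lemma perm_bump : k < size r -> perm_eq (y :: set_nth 0 r k x) (x :: r).
Proof.
move=> bump; have split_r : r = take k r ++ y :: drop k.+1 r.
  by rewrite -drop_nth // cat_take_drop.
apply/seq.permP => a; rewrite set_nthE bump [in RHS]split_r /= !count_cat /=; lia.
Qed.

Lemma bumped_least : sorted ltn r -> {in r, forall v, x < v -> y <= v}.
Proof.
move=> sorted_r v vr xv; have le_k : k <= index v r.
  by rewrite leqNgt; apply/negP => /(before_find 0); rewrite nth_index // xv.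
have /(sorted_leq_nth leq_trans leqnn 0) le_nth : sorted leq r.
  by apply: sub_sorted sorted_r => a b /ltnW.
rewrite -(nth_index 0 vr); apply: le_nth; rewrite ?inE ?index_mem //.
by apply: leq_ltn_trans le_k _; rewrite index_mem.
Qed.

Hypothesis x_notin_r : x \notin r.

Lemma lt_of_no_bump : size r <= k -> {in r, forall v, v < x}.
Proof.
rewrite leqNgt -has_find => /hasPn no_gt v vr.
rewrite ltn_neqAle leqNgt no_gt // andbT.
by apply: contraNneq x_notin_r => <-.
Qed.

Lemma sorted_bump : k < size r -> sorted ltn r -> sorted ltn (set_nth 0 r k x).
Proof.
move=> bump sorted_r; have split_r : r = take k r ++ y :: drop k.+1 r.
  by rewrite -drop_nth // cat_take_drop.
have := sorted_r; rewrite set_nthE bump {1}split_r !(sorted_pairwise ltn_trans).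
rewrite !pairwise_cat !allrel_consr /= => /and3P[/andP[_ ->] -> /andP[gt_y ->]].
rewrite !andbT; apply/andP; split; apply/allP => v; last first.
  by move=> /(allP gt_y); apply: ltn_trans (lt_bumped bump).
move=> /[dup] /mem_take vr /(nthP 0)[l]; rewrite size_take bump => lk.
rewrite nth_take // => nth_l; have := before_find 0 lk.
rewrite nth_l => not_gt; rewrite /= ltn_neqAle leqNgt not_gt andbT.
by apply: contraNneq x_notin_r => <-.
Qed.

End BumpedRow.

Definition avoids321 (w : seq nat) := forall i j k,
  i < j -> j < k -> k < size w -> ~ (nth 0 w k < nth 0 w j < nth 0 w i).

Lemma avoids321_rcons w x : avoids321 (rcons w x) -> avoids321 w.
Proof.
move=> av i j k ij jk kw; have jw := ltn_trans jk kw.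
have := av i j k ij jk; rewrite size_rcons !nth_rcons kw jw (ltn_trans ij jw).
by apply; apply: ltnW.
Qed.

Lemma avoids321_descent w x i j : avoids321 (rcons w x) ->
  i < j < size w -> nth 0 w j < nth 0 w i -> nth 0 w j <= x.
Proof.
move=> av /andP[ij jw] descent; rewrite leqNgt; apply/negP => gt_x.
apply: (av i j (size w) ij jw); rewrite ?size_rcons // !nth_rcons jw (ltn_trans ij jw).
by rewrite ltnn eqxx gt_x.
Qed.

Lemma RSK_rcons w x : RSK (rcons w x) = rsk_step (RSK w) (size w, x).
Proof.
rewrite /RSK size_rcons -addn1 iotaD cats1 add0n zip_rcons ?size_iota //.
by rewrite foldl_rcons.
Qed.

(* The lists P1 and Q1 are aligned: [(y, t) \in zip P1 Q1] when the letter in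
   position t bumps the letter y out of the first row. *)
Record bump_spec (w P0 P1 Q1 : seq nat) : Prop := BumpSpec {
  bump_size : size P1 = size Q1;
  bump_uniq : uniq Q1;
  bump_perm : perm_eq (P0 ++ P1) w;
  bump_sorted : sorted ltn P0;
  bump_inversion : forall y t, (y, t) \in zip P1 Q1 ->
    [/\ index y w < t, t < size w & nth 0 w t < y];
  bump_least : forall y t v, (y, t) \in zip P1 Q1 -> v \in P0 -> index v w < t ->
    nth 0 w t < v -> y < v;
  bump_forced : forall i j, i < j < size w -> nth 0 w j < nth 0 w i -> j \notin Q1 ->
    exists2 t, (nth 0 w i, t) \in zip P1 Q1 & t < j
}.

Section BumpStep.

Variables (w P0 P1 Q1 : seq nat) (x : nat).
Hypothesis spec : bump_spec w P0 P1 Q1.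

Let k := find (fun y => x < y) P0.
Let y := nth 0 P0 k.

Let mem_w z : (z \in w) = (z \in P0) || (z \in P1).
Proof. by rewrite -(perm_mem (bump_perm spec)) mem_cat. Qed.

Let unzip1_bumps : unzip1 (zip P1 Q1) = P1.
Proof. by apply: unzip1_zip; rewrite (bump_size spec). Qed.

Let unzip2_bumps : unzip2 (zip P1 Q1) = Q1.
Proof. by apply: unzip2_zip; rewrite (bump_size spec). Qed.

Lemma bumped_mem z t : (z, t) \in zip P1 Q1 -> z \in w.
Proof.
by rewrite mem_w -{2}unzip1_bumps => /(map_f fst) /= ->; rewrite orbT.
Qed.

Lemma bumpedP z : z \in P1 -> exists t, (z, t) \in zip P1 Q1.
Proof.
by rewrite -{1}unzip1_bumps => /mapP[[z' t] zt ->]; exists t.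
Qed.

Lemma bumping_lt_size t : t \in Q1 -> t < size w.
Proof.
by rewrite -unzip2_bumps => /mapP[[z t'] /(bump_inversion spec)[] // _ lt_w _ ->].
Qed.

(* A letter z of the second row above y would give an occurrence of 321: z, the
   letter that bumped z or y, and x. *)
Lemma bumped_gt_row1 : uniq w -> avoids321 (rcons w x) -> k < size P0 ->
  {in P1, forall z, z < y}.
Proof.
move=> uniq_w av bump z zP1; have xy : x < y := lt_bumped bump.
have yP0 : y \in P0 by rewrite mem_nth.
have yw : y \in w by rewrite mem_w yP0.
have z_neq_y : y != z.
  have : uniq (P0 ++ P1) by rewrite (perm_uniq (bump_perm spec)).
  by rewrite cat_uniq => /and3P[_ /hasPn/(_ _ zP1) + _]; apply: contraNneq => <-.
have [t zt] := bumpedP zP1; have [z_before_t tw inv] := bump_inversion spec zt.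
have zw := bumped_mem zt; rewrite ltnNge leq_eqVlt negb_or z_neq_y; apply/negP => yz.
case: (leqP t (index y w)) => [t_le_y|y_before_t].
  have := @avoids321_descent w x (index z w) (index y w) av.
  by rewrite index_mem yw !nth_index // => /(_ _ yz); lia.
have := @avoids321_descent w x (index z w) t av; rewrite tw nth_index // => /(_ _ inv).
by have := bump_least spec zt yP0 y_before_t; lia.
Qed.

Hypothesis x_notin_w : x \notin w.

Let index_w z : z \in w -> index z (rcons w x) = index z w.
Proof. by move=> zw; rewrite -cats1 index_cat zw. Qed.

Let nth_w i : i < size w -> nth 0 (rcons w x) i = nth 0 w i.
Proof. by move=> iw; rewrite nth_rcons iw. Qed.

Let index_x : index x (rcons w x) = size w.
Proof. by rewrite -cats1 index_cat (negbTE x_notin_w) /= eqxx addn0. Qed.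

Lemma bump_inversion_rcons z t : (z, t) \in zip P1 Q1 ->
  [/\ index z (rcons w x) < t, t < size (rcons w x) & nth 0 (rcons w x) t < z].
Proof.
move=> zt; have [? lt_w ?] := bump_inversion spec zt.
by rewrite (index_w (bumped_mem zt)) nth_w // size_rcons ltnS (ltnW lt_w).
Qed.

Lemma bump_least_rcons z t v : (z, t) \in zip P1 Q1 -> v \in x :: P0 ->
  index v (rcons w x) < t -> nth 0 (rcons w x) t < v -> z < v.
Proof.
move=> zt; have [_ lt_w _] := bump_inversion spec zt; rewrite nth_w // inE.
case/predU1P => [->|vP0]; first by rewrite index_x; lia.
rewrite index_w ?mem_w ?vP0 //; exact: (bump_least spec zt).
Qed.

Lemma bump_forced_rcons i j : i < j < size w ->
  nth 0 (rcons w x) j < nth 0 (rcons w x) i -> j \notin Q1 ->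
  exists2 t, (nth 0 (rcons w x) i, t) \in zip P1 Q1 & t < j.
Proof.
move=> /[dup] /andP[ij jw] ijw; rewrite !nth_w ?(ltn_trans ij) //.
exact: (bump_forced spec).
Qed.

Lemma bump_spec_append : {in P0, forall z, z < x} ->
  bump_spec (rcons w x) (rcons P0 x) P1 Q1.
Proof.
move=> gt_P0; split.
- exact: bump_size spec.
- exact: bump_uniq spec.
- rewrite cat_rcons -cat1s perm_catCA cat1s perm_sym perm_rcons perm_cons perm_sym.
  exact: bump_perm spec.
- case: P0 gt_P0 (bump_sorted spec) => //= a r gt_P0.
  by rewrite rcons_path => ->; apply/gt_P0/mem_last.
- exact: bump_inversion_rcons.
- by move=> z t v zt; rewrite mem_rcons; apply: bump_least_rcons.
- move=> i j; rewrite size_rcons ltnS => /andP[ij]; rewrite leq_eqVlt.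
  case/predU1P => [Ej|jw] descent jQ1; last by apply: bump_forced_rcons; rewrite ?ij.
  move: descent; rewrite Ej nth_rcons ltnn eqxx nth_w -?Ej // => gt_x.
  have : nth 0 w i \in w by rewrite mem_nth -?Ej.
  rewrite mem_w => /orP[/gt_P0|]; first by lia.
  by case/bumpedP => t zt; exists t; rewrite ?Ej //; have [] := bump_inversion spec zt.
Qed.

Lemma bump_spec_bump : uniq w -> k < size P0 ->
  bump_spec (rcons w x) (set_nth 0 P0 k x) (rcons P1 y) (rcons Q1 (size w)).
Proof.
move=> uniq_w bump; have x_notin_P0 : x \notin P0.
  by apply: contra x_notin_w; rewrite mem_w => ->.
have xy : x < y := lt_bumped bump.
have yw : y \in w by rewrite mem_w mem_nth.
have perm_P0' : perm_eq (y :: set_nth 0 P0 k x) (x :: P0) := perm_bump bump.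
have new_row v : v \in set_nth 0 P0 k x -> v != y /\ v \in x :: P0.
  move=> vP0'; split; last by rewrite -(perm_mem perm_P0') inE vP0' orbT.
  have : uniq (y :: set_nth 0 P0 k x).
    rewrite (perm_uniq perm_P0') /= x_notin_P0; move: uniq_w.
    by rewrite -(perm_uniq (bump_perm spec)) cat_uniq => /andP[].
  by move=> /andP[+ _]; apply: contraNneq => <-.
split; rewrite ?zip_rcons ?(bump_size spec) //.
- by rewrite !size_rcons (bump_size spec).
- rewrite rcons_uniq (bump_uniq spec) andbT.
  by apply/negP => /bumping_lt_size; rewrite ltnn.
- apply/seq.permP => a; have := seq.permP perm_P0' a; have := seq.permP (bump_perm spec) a.
  by rewrite -!cats1 !count_cat /=; lia.
- exact: sorted_bump x_notin_P0 bump (bump_sorted spec).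
- move=> z t; rewrite mem_rcons inE => /predU1P[[-> ->]|]; last exact: bump_inversion_rcons.
  by rewrite index_w // index_mem yw size_rcons nth_rcons ltnn eqxx.
- move=> z t v; rewrite mem_rcons inE => zt /new_row[v_neq_y].
  case/predU1P: zt => [[-> ->]|]; last exact: bump_least_rcons.
  rewrite nth_rcons ltnn eqxx inE => /predU1P[->|vP0 _ xv]; first by rewrite index_x ltnn.
  by rewrite ltn_neqAle eq_sym v_neq_y (bumped_least (bump_sorted spec)).
- move=> i j /andP[ij]; rewrite size_rcons ltnS mem_rcons inE negb_or => jw descent.
  case/andP => j_neq jQ1; have ltjw : j < size w by rewrite ltn_neqAle j_neq.
  have [|t yt tj] := @bump_forced_rcons i j _ descent jQ1; first by rewrite ij.
  by exists t; rewrite // mem_rcons inE yt orbT.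
Qed.

End BumpStep.

Lemma RSK_bump_spec w : uniq w -> avoids321 w ->
  bump_spec w (row (RSK w).1 0) (row (RSK w).1 1) (row (RSK w).2 1).
Proof.
elim/last_ind: w => [|w x IH]; first by split=> // i j; rewrite ltn0 andbF.
rewrite rcons_uniq => /andP[x_notin_w uniq_w] av.
have := IH uniq_w (avoids321_rcons av); rewrite RSK_rcons /rsk_step.
case: (RSK w) => P Q /= spec {IH}.
have x_notin_P0 : x \notin row P 0.
  by apply: contra x_notin_w; rewrite -(perm_mem (bump_perm spec)) mem_cat => ->.
case: (ltnP (find (fun y => x < y) (row P 0)) (size (row P 0))) => [bump|no_bump].
  rewrite row_insert_bump // row_insert_append ?nth_behead /=; last first.
    by move=> z zP1; apply/ltnW/(bumped_gt_row1 spec uniq_w av).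
  by rewrite nth_set_nth /=; apply: bump_spec_bump.
have lt_x := lt_of_no_bump x_notin_P0 no_bump.
rewrite row_insert_append => [|y /lt_x/ltnW //].
by rewrite /= nth_set_nth /= nth_behead; apply: bump_spec_append.
Qed.

End RowInsertion.

(** * The matching of a permutation avoiding 321 *)

Section Word.

Variables (n : nat) (s : 'S_n).

Lemma size_word : size (word s) = n.
Proof. by rewrite size_map size_enum_ord. Qed.

Lemma nth_word (i : 'I_n) : nth 0 (word s) i = s i.
Proof. by rewrite (nth_map i) ?size_enum_ord // nth_ord_enum. Qed.

Lemma mem_word (i : 'I_n) : (s i : nat) \in word s.
Proof. by apply/mapP; exists i; rewrite ?mem_enum. Qed.

Lemma uniq_word : uniq (word s).
Proof. by rewrite map_inj_uniq ?enum_uniq // => i j /val_perm_inj. Qed.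

Lemma index_word (i : 'I_n) : index (s i : nat) (word s) = i.
Proof. by rewrite -nth_word index_uniq ?uniq_word ?size_word. Qed.

Lemma Av321_avoids : s \in Av n [:: 3; 2; 1] -> perm_avoids321 s.
Proof.
rewrite inE => /negP no_321 i j k ij jk /andP[skj sji]; apply: no_321.
apply/existsP; exists [ffun t : 'I_3 => nth k [:: i; j] t].
apply/forallP => -[[|[|[|//]]] ?]; apply/forallP => -[[|[|[|//]]] ?].
all: by rewrite !ffunE /=; lia.
Qed.

Lemma avoids321_word : perm_avoids321 s -> avoids321 (word s).
Proof.
move=> s_avoids i j k ij jk; rewrite size_word => kn.
have jn := ltn_trans jk kn; have ltn_i := ltn_trans ij jn.
rewrite (nth_word (Ordinal kn)) (nth_word (Ordinal jn)) (nth_word (Ordinal ltn_i)).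
exact: s_avoids.
Qed.

End Word.

Section RowsMatching.

Variables (n : nat) (s : 'S_n) (P0 P1 Q1 : seq nat).
Hypothesis spec : bump_spec (word s) P0 P1 Q1.

Lemma rows_uniq : uniq (P0 ++ P1).
Proof. by rewrite (perm_uniq (bump_perm spec)) uniq_word. Qed.

Lemma mem_row0 (i : 'I_n) : ((s i : nat) \in P0) = ((s i : nat) \notin P1).
Proof.
have := rows_uniq; rewrite cat_uniq => /and3P[_ /hasPn disjoint _].
have := mem_word s i; rewrite -(perm_mem (bump_perm spec)) mem_cat.
by case: (boolP (_ \in P1)) => [/disjoint/negbTE //|_]; rewrite orbF.
Qed.

Lemma mem_zip_nth k : k < size P1 -> (nth 0 P1 k, nth 0 Q1 k) \in zip P1 Q1.
Proof.
have size_eq := bump_size spec => lt_k.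
by rewrite -nth_zip // mem_nth // size_zip -size_eq minnn.
Qed.

Lemma rows_functions : exists bumpee bumper : 'I_(size P1) -> 'I_n,
  (forall k, s (bumpee k) = nth 0 P1 k :> nat) /\
  (forall k, bumper k = nth 0 Q1 k :> nat).
Proof.
have /fin_all_exists[bumpee bumpeeE] (k : 'I_(size P1)) :
    exists i : 'I_n, s i = nth 0 P1 k :> nat.
  by have /mapP[i _ ->] := bumped_mem spec (mem_zip_nth (ltn_ord k)); exists i.
have /fin_all_exists[bumper bumperE] (k : 'I_(size P1)) :
    exists j : 'I_n, j = nth 0 Q1 k :> nat.
  have [_ lt_n _] := bump_inversion spec (mem_zip_nth (ltn_ord k)).
  by rewrite size_word in lt_n; exists (Ordinal lt_n).
by exists bumpee, bumper.
Qed.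

Variables bumpee bumper : 'I_(size P1) -> 'I_n.
Hypotheses (bumpeeE : forall k, s (bumpee k) = nth 0 P1 k :> nat)
  (bumperE : forall k, bumper k = nth 0 Q1 k :> nat).

Lemma mem_codom_bumpee (i : 'I_n) : (i \in codom bumpee) = ((s i : nat) \in P1).
Proof.
apply/codomP/(nthP 0) => [[k ->]|[k lt_k nth_k]]; first by exists k; rewrite ?bumpeeE.
by exists (Ordinal lt_k); apply: (@val_perm_inj _ s); rewrite bumpeeE.
Qed.

Lemma mem_codom_bumper (j : 'I_n) : (j \in codom bumper) = ((j : nat) \in Q1).
Proof.
have size_eq := bump_size spec.
apply/codomP/(nthP 0) => [[k ->]|[k lt_k nth_k]].
  by exists k; rewrite -?size_eq ?bumperE.
by rewrite -size_eq in lt_k; exists (Ordinal lt_k); apply: val_inj; rewrite /= bumperE.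
Qed.

Lemma mem_bumps k : ((s (bumpee k) : nat), (bumper k : nat)) \in zip P1 Q1.
Proof. by rewrite bumpeeE bumperE mem_zip_nth. Qed.

Lemma bumpsP y t : (y, t) \in zip P1 Q1 ->
  exists2 k, s (bumpee k) = y :> nat & bumper k = t :> nat.
Proof.
have size_eq := bump_size spec; move=> /(nthP (0, 0))[k].
rewrite size_zip -size_eq minnn nth_zip // => lt_k [<- <-].
by exists (Ordinal lt_k); rewrite ?bumpeeE ?bumperE.
Qed.

Lemma rows_matching : bump_matching s bumpee bumper.
Proof.
have inj_bumpee : injective bumpee.
  move=> k l /(congr1 (fun i => s i : nat))/eqP; have := rows_uniq; rewrite cat_uniq.
  by case/and3P=> _ _ uniq_P1; rewrite !bumpeeE nth_uniq // => /eqP/val_inj.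
have forced (i j : 'I_n) : inversion s i j -> j \notin codom bumper ->
    exists2 k, bumpee k = i & bumper k < j.
  case/andP => ij sji; rewrite mem_codom_bumper => jQ1.
  have [||t] := bump_forced spec _ _ jQ1 (i := i); rewrite ?size_word ?ij ?nth_word //=.
  by case/bumpsP => k /val_perm_inj <- <-; exists k.
split=> //.
- move=> k l /(congr1 (@nat_of_ord n))/eqP.
  by rewrite !bumperE nth_uniq ?(bump_uniq spec) -?(bump_size spec) // => /eqP/val_inj.
- move=> k; have [] := bump_inversion spec (mem_bumps k).
  by rewrite index_word nth_word /inversion => -> _ ->.
- move=> i j inv; case: (boolP (j \in codom bumper)) => [_|/(forced _ _ inv)[k <- _]].
    by rewrite orbT.
  by rewrite codom_f.
- by move=> k j inv /(forced _ _ inv)[l /inj_bumpee <-].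
- move=> k i /andP[? ?]; rewrite mem_codom_bumpee -mem_row0 => iP0.
  by apply: (bump_least spec (mem_bumps k)); rewrite ?index_word ?nth_word.
Qed.

End RowsMatching.

Lemma Psi_matching n (s : 'S_n) : perm_avoids321 s ->
  exists (K : finType) (bumpee bumper : K -> 'I_n),
    bump_matching s bumpee bumper /\ matching_path s bumpee bumper (Psi s).
Proof.
move=> /avoids321_word/(RSK_bump_spec (uniq_word s)).
rewrite /Psi; case: (RSK _) => P Q /= spec.
have [bumpee [bumper [bumpeeE bumperE]]] := rows_functions spec.
exists _, bumpee, bumper; split; first exact: (rows_matching spec).
split.
- by rewrite size_cat !size_map size_rev size_iota addnn.
- move=> i; rewrite nth_cat size_map size_iota ltn_ord (nth_map 0) ?size_iota //.
  by rewrite nth_iota // (mem_row0 spec) (mem_codom_bumpee bumpeeE).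
- move=> j; rewrite rev_cat nth_cat size_rev size_map size_rev size_iota ltn_ord.
  rewrite -map_rev revK (nth_map 0) ?size_iota // nth_iota //.
  by rewrite (mem_codom_bumper spec bumperE).
Qed.

Theorem theorem3p3 (n : nat) (hn : 0 < n) (s : 'S_n)
    (hs : s \in Av n [:: 3; 2; 1]) :
  (fp (Theta s), exc (Theta s), crs (Theta s)) = (fp s, exc s, crs s).
Proof.
have s_avoids := Av321_avoids hs.
have [K [bumpee [bumper [M path_Psi]]]] := Psi_matching s_avoids.
rewrite /Theta (fp_preserved s_avoids M path_Psi) (exc_preserved s_avoids M path_Psi).
by rewrite (crs_preserved s_avoids M path_Psi).
Qed.
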